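(* Let $n=2$ and $V_0=\omega=(1,\nu)$, where $\nu$ is an irrational number with Diophantine exponent $1\le\tau(\nu)<\infty$. Then, for any $0<r<\tau(\nu)$, there exist a sequence $\{\delta_j\}_{j\in\mathbb{N}}$ with $\delta_j>0$ and $\delta_j\to0$ as $j\to\infty$, a corresponding sequence of Lipschitz vector fields $V_{\delta_j}:\mathbb{T}^2\to\mathbb{R}^2$ satisfying $$\sup_{x\in\mathbb{T}^2}|V_0-V_{\delta_j}(x)|=\delta_j,$$ and a constant $c>0$ independent of $j$, such that $$W_1\bigl(\widetilde{\mathfrak{M}}_0,\widetilde{\mathfrak{M}}_{\delta_j}\bigr)\ge c\,\delta_j^{1/(r+1)}\qquad\text{for all } j\in\mathbb{N},$$ where $\widetilde{\mathfrak{M}}_{\delta_j}$ denotes an arbitrary Mather measure of the Lagrangian $L_{\delta_j}(x,v)=\frac12|v-V_{\delta_j}(x)|^2$ and $\widetilde{\mathfrak{M}}_0$ is the unique Mather measure of $L_0(x,v)=\frac12|v-\omega|^2$.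
   Context: $\mathbb{T}^2=\mathbb{R}^2/\mathbb{Z}^2$ is the flat torus and $T\mathbb{T}^2=\mathbb{T}^2\times\mathbb{R}^2$ carries the Euclidean product distance. For irrational $\nu\in\mathbb{R}$ the Diophantine exponent is $\tau(\nu)=\sup\{\gamma\ge0:\liminf_{m\to+\infty}m^\gamma\|m\nu\|_{\mathbb{Z}}=0\}$, where $\|\cdot\|_{\mathbb{Z}}$ is the distance to the nearest integer. A Borel probability measure $\mu$ on $T\mathbb{T}^2$ is closed if $\int|v|\,d\mu<\infty$ and $\int d\phi(x)\cdot v\,d\mu(x,v)=0$ for all $\phi\in C^1(\mathbb{T}^2,\mathbb{R})$. A Mather measure of a Lagrangian $L$ is a closed probability measure minimizing $\int L\,d\mu$ among all closed probability measures. Convention: the symbol $\widetilde{\mathfrak{M}}_\delta$ stands for an arbitrary choice of a Mather measure of $L_\delta$. $W_1(\mu,\nu)=\inf_{\Pi}\int d(x,y)\,d\Pi(x,y)$ is the 1-Wasserstein distance (infimum over couplings $\Pi$ of $\mu$ and $\nu$) on $T\mathbb{T}^2$. *)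

(* Defs.v *)
From HB Require Import structures.
From mathcomp Require Import all_boot all_order all_algebra.
From mathcomp Require Import generic_quotient.
From mathcomp Require Import all_classical all_reals all_analysis.

Set Implicit Arguments.
Unset Strict Implicit.
Unset Printing Implicit Defensive.
Import Order.TTheory GRing.Theory Num.Theory.
Import numFieldNormedType.Exports.
Local Open Scope classical_set_scope.
Local Open Scope ring_scope.
Local Open Scope quotient_scope.

(* The plane is [R * R]; the norm MathComp puts on a product is the max norm,
   so the Euclidean one is spelled out. *)
Definition enorm (R : realType) (v : R * R) : R :=
  Num.sqrt (v.1 ^+ 2 + v.2 ^+ 2).

Section Torus.
Variable R : realType.

Definition zequiv (x y : R * R) : bool :=
  (x.1 - y.1 \is a Num.int) && (x.2 - y.2 \is a Num.int).

Fact zequiv_refl : reflexive zequiv.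
Proof. by move=> x; rewrite /zequiv !subrr !rpred0. Qed.

Fact zequiv_sym : symmetric zequiv.
Proof.
move=> x y; rewrite /zequiv.
by rewrite -(opprB y.1) -(opprB y.2) !rpredN.
Qed.

Fact zequiv_trans : transitive zequiv.
Proof.
move=> y x z /andP[a1 a2] /andP[b1 b2]; apply/andP; split.
- by rewrite -(subrKA y.1) rpredD.
- by rewrite -(subrKA y.2) rpredD.
Qed.

Canonical zequiv_equiv :=
  EquivRel zequiv zequiv_refl zequiv_sym zequiv_trans.

Definition torus : Type := quotient_topology {eq_quot zequiv}.

HB.instance Definition _ := EqQuotient.copy torus {eq_quot zequiv}.
HB.instance Definition _ :=
  Topological.copy torus (quotient_topology {eq_quot zequiv}).
HB.instance Definition _ := isPointed.Build torus (\pi_torus (0, 0)).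

Definition torus_dist (x y : torus) : R :=
  inf [set enorm (repr x - repr y - (k.1%:~R, k.2%:~R)) | k in [set: int * int]].

(* T T^2 = T^2 * R^2, equipped with its Borel sigma-algebra. *)
Definition phase : Type :=
  g_sigma_algebraType [set U : set (torus * (R * R)) | open U].

HB.instance Definition _ := Measurable.on phase.

Definition phase_dist (z w : phase) : R :=
  Num.sqrt (torus_dist z.1 w.1 ^+ 2 + enorm (z.2 - w.2) ^+ 2).

Definition lift (phi : torus -> R) : R * R -> R := phi \o \pi_torus.

(* Pointwise continuity of the differential is continuity in operator norm,
   the plane being finite dimensional. *)
Definition C1 (phi : torus -> R) : Prop :=
  (forall p, differentiable (lift phi) p) /\
  (forall v : R * R, continuous (fun p => 'd (lift phi) p v)).

(* [lift phi] is periodic, so the choice of representative is irrelevant. *)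
Definition torus_diff (phi : torus -> R) (x : torus) (v : R * R) : R :=
  'd (lift phi) (repr x) v.

Definition closed_measure (mu : probability phase R) : Prop :=
  (\int[mu]_z (enorm z.2)%:E < +oo)%E /\
  forall phi, C1 phi -> (\int[mu]_z (torus_diff phi z.1 z.2)%:E = 0)%E.

Definition mather_measure (L : phase -> R) (mu : probability phase R) : Prop :=
  closed_measure mu /\
  forall mu' : probability phase R, closed_measure mu' ->
    (\int[mu]_z (L z)%:E <= \int[mu']_z (L z)%:E)%E.

Definition lagrangian (V : torus -> R * R) (z : phase) : R :=
  2^-1 * enorm (z.2 - V z.1) ^+ 2.

Definition lipschitz_field (V : torus -> R * R) : Prop :=
  exists K : R, forall x y, enorm (V x - V y) <= K * torus_dist x y.

Definition coupling (mu nu : probability phase R)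
    (Pi : probability (phase * phase)%type R) : Prop :=
  (forall A, measurable A -> Pi (A `*` setT) = mu A) /\
  (forall B, measurable B -> Pi (setT `*` B) = nu B).

Definition W1 (mu nu : probability phase R) : \bar R :=
  ereal_inf [set (\int[Pi]_p (phase_dist p.1 p.2)%:E)%E | Pi in coupling mu nu].

End Torus.

Definition distZ (R : realType) (x : R) : R :=
  inf [set `|x - k%:~R| | k in [set: int]].

Definition dioph_exponent (R : realType) (nu : R) : \bar R :=
  ereal_sup [set g%:E | g in [set g : R | 0 <= g /\
    limn_einf (fun m => (m%:R `^ g * distZ (m%:R * nu))%:E) = 0%E]].

(* Main.v *)
Require Import Defs.
From HB Require Import structures.
From mathcomp Require Import all_boot all_order all_algebra generic_quotient.
From mathcomp Require Import all_classical all_reals all_analysis.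
From mathcomp Require Import measurable_realfun ring lra.

(** The Lagrangian [|v - V(x)|^2 / 2] is nonnegative. Hence, as soon as some
closed measure of zero action exists, every Mather measure has zero action
and lives on the graph [v = V(x)]; closedness then reads
[int dphi(x).V(x) dmu = 0] for all C^1 functions [phi] ([mather_ae]).
Everything is extracted from this identity with [phi] a wave
[x |-> cos (2 pi k.x + a)], whose differential along [v] is [2 pi k.v] times
the same wave advanced by a quarter of a period ([closed_wave]).

The linear flow. For [V = omega = (1, nu)] the factor [k.omega] vanishes only
for [k = 0], because [nu] is irrational, so every wave of nonzero frequency
has integral 0 ([linear_mather_wave]). Two Mather measures thus agree on
waves, and then on every function obtained from waves by linear combinations
and bounded pointwise limits ([tc_integral_eq]). This class is closed under
products, and under taking signs, since [sgn] is on [[-1, 1]] the limit of the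
iterates of the polynomial [(3 s - s^3) / 2]. It therefore contains the
indicators of arcs, of open sets ([tc_set_open]), and of the slices
[{x | (x, omega) in A}] of Borel sets ([tc_slice]): the Mather measure is
unique. It exists because Lebesgue measure on the unit square is closed for
every constant velocity, by Fubini and periodicity ([linear_flow_measure]).
The vanishing of wave integrals also says that [sin^2 (2 pi k.x)] has mean 1/2
for this measure when [k <> 0].

The perturbation. Since [r] is below the exponent, there are arbitrarily large
[m], with integers [p], such that [|m nu - p| < m^(-r)] ([dioph_approx]). Put
[eta = |nu - p/m|] and
[V(x) = (1, p/m + eta sin (2 pi (m x_2 - p x_1)))].
The distance from [V] to [omega] is [delta = 2 eta], attained where the sine is
[1] or [-1] ([resonant_field_sup]). The field is tangent to the closed orbit
through 0, in the direction [(m, p)], so zero action is achieved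
([resonant_orbit_measure]). For [k = (-p, m)] one has
[k.V(x) = m eta sin (2 pi k.x)], and the wave test gives
[int sin^2 (2 pi k.x) dmu = 0]: every Mather measure lives on the circles
[sin (2 pi k.x) = 0] ([resonant_mather_ae]).

Neighbouring circles are at a distance of order [1/m], and so is the uniform
measure from any measure that they carry. Precisely, [sin^2 (2 pi k.x)] has Lipschitz constant at most
[4 pi (|p| + m)], of order [m]; its mean is 1/2 for the first measure and 0 for
the second, and the easy half of Kantorovich duality ([W1_ge]) bounds [W1]
below by a multiple of [1/m]. As [delta < 2 m^(-(r+1))], this is at least a
multiple of [delta^(1/(r+1))] ([rate_le]). *)

Set Implicit Arguments.
Unset Strict Implicit.
Unset Printing Implicit Defensive.
Import Order.TTheory GRing.Theory Num.Theory.
Import numFieldNormedType.Exports.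
Local Open Scope classical_set_scope.
Local Open Scope ring_scope.
Local Open Scope quotient_scope.

(** * Rational boxes in the plane *)

Section Plane.
Variable R : realType.
Implicit Types (p : R * R) (i : rat * rat * nat).

(** The radii [1/(n+3)] stay below 1/2, so that a box is disjoint from its
translates by nonzero integer vectors and is seen faithfully on the torus. *)
Definition box i : set (R * R) :=
  [set p | `|p.1 - ratr i.1.1| < i.2.+3%:R^-1 /\
           `|p.2 - ratr i.1.2| < i.2.+3%:R^-1].

Lemma boxE i : box i = ball (ratr i.1.1 : R) i.2.+3%:R^-1 `*`
                       ball (ratr i.1.2 : R) i.2.+3%:R^-1.
Proof.
by apply/seteqP; split=> p; rewrite /box /ball /= (distrC p.1) (distrC p.2).
Qed.

Lemma rat_approx (x e : R) : 0 < e -> exists q : rat, `|x - ratr q| < e.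
Proof.
move=> e0; have [|q] := @rat_in_itvoo R (x - e) (x + e); first by lra.
rewrite in_itv /= => /andP[h1 h2]; exists q.
by rewrite ltr_norml; apply/andP; split; lra.
Qed.

Lemma open_rat_box (O : set (R * R)) p : open O -> O p ->
  exists2 i, box i p & box i `<=` O.
Proof.
rewrite openE => oO Op; have [e /= e0 be] := (nbhs_ballP _ _).1 (oO _ Op).
have [n] : exists n : nat, (n.+3%:R : R)^-1 < e / 2.
  have [n _ hn] := near_infty_natSinv_lt (PosNum (divr_gt0 e0 (ltr0n R 2))).
  exists n; apply: le_lt_trans (hn n (leqnn n)).
  by rewrite /= lef_pV2 ?posrE ?ltr0n// ler_nat ltnW.
(* Moving the centre to a rational point costs at most one radius. *)
set d := n.+3%:R^-1 => dn; have d0 : 0 < d by rewrite invr_gt0 ltr0n.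
have [q1 h1] := rat_approx p.1 d0; have [q2 h2] := rat_approx p.2 d0.
exists ((q1, q2), n) => // -[y1 y2] [/=]; rewrite -/d => k1 k2.
apply: be; split => /=.
- rewrite /ball /= -(subrKA (ratr q1)).
  by rewrite (le_lt_trans (ler_normD _ _))// (distrC (ratr q1)); lra.
- rewrite /ball /= -(subrKA (ratr q2)).
  by rewrite (le_lt_trans (ler_normD _ _))// (distrC (ratr q2)); lra.
Qed.

(** The boxes form a countable family: this is what turns statements about
open sets into countable operations, both here in the plane and, later, on
the torus. *)
Lemma open_bigcup_box (O : set (R * R)) : open O ->
  O = \bigcup_(i in [set i | box i `<=` O]) box i.
Proof.
move=> oO; apply/seteqP; split => [p Op|p [i /= + ip]]; last by apply.
by have [i ip iO] := open_rat_box oO Op; exists i.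
Qed.

(** The Borel sets of the plane belong to the product sigma-algebra of two
lines, on which product measures are defined. *)
Lemma measurable_plane_open (O : set (R * R)) : open O -> measurable O.
Proof.
move=> oO; rewrite (open_bigcup_box oO) bigcup_mkcond.
apply: countable_bigcupT_measurable => [|i]; first exact: countableP.
case: ifP => // _; rewrite boxE.
by apply: measurableX; rewrite ball_itv; exact: measurable_itv.
Qed.

End Plane.

(** * The torus and its waves *)

Section TorusLemmas.
Variable R : realType.
Implicit Types (p q v : R * R) (x y : torus R) (k : int * int).

Definition dotz k p : R := k.1%:~R * p.1 + k.2%:~R * p.2.

Lemma dotzD k p q : dotz k (p + q) = dotz k p + dotz k q.
Proof. by rewrite /dotz /=; ring. Qed.

Lemma dotzZ k t p : dotz k (t *: p) = t * dotz k p.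
Proof. by rewrite /dotz /= /GRing.scale /=; ring. Qed.

Lemma pi_eqP p q : reflect (exists l : int * int,
  q = p + (l.1%:~R, l.2%:~R)) (\pi_(torus R) p == \pi_(torus R) q).
Proof.
apply: (iffP idP) => [|[l ->]].
  rewrite eqmodE /= => /andP[] /intrP[a ha] /intrP[b hb].
  exists (- a, - b); case: p q ha hb => [p1 p2] [q1 q2] /= ha hb.
  by rewrite !rmorphN /= -ha -hb; congr pair; rewrite /=; ring.
rewrite eqmodE /= /zequiv /=; apply/andP; split.
- by rewrite opprD addrA subrr sub0r rpredN intr_int.
- by rewrite opprD addrA subrr sub0r rpredN intr_int.
Qed.

Lemma repr_piE p : exists l : int * int,
  repr (\pi_(torus R) p) = p + (l.1%:~R, l.2%:~R).
Proof. by apply/pi_eqP; rewrite reprK. Qed.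

Lemma cosD_int (u : R) (l : int) : cos (u + 2 * pi * l%:~R) = cos u.
Proof.
have H n w : cos (w + 2 * pi * n%:R) = cos w :> R.
  have -> : 2 * pi * n%:R = pi *+ 2 *+ n :> R.
    by rewrite -[RHS]mulr_natr -[in RHS](mulr_natl pi 2).
  exact: periodicn (@cosD2pi R) n w.
case: l => n; first exact: H.
rewrite NegzE rmorphN /= -[n.+1%:~R]/(n.+1%:R) -(H n.+1 (u + _)).
by congr cos; ring.
Qed.

Lemma torus_continuous (Z : topologicalType) (f : torus R -> Z) :
  continuous (f \o \pi_(torus R)) -> continuous f.
Proof. by move=> cf; apply/quotient_continuous. Qed.

(** The phase [a] puts cosines and sines in a single family, which is stable
under differentiation (the phase moves by [pi / 2]) and, up to sums, under
products. *)
Definition wave k (a : R) x : R := cos (2 * pi * dotz k (repr x) + a).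

Lemma wave_pi k a p : wave k a (\pi_(torus R) p) = cos (2 * pi * dotz k p + a).
Proof.
rewrite /wave; have [l ->] := repr_piE p.
rewrite dotzD -[RHS](cosD_int _ (k.1 * l.1 + k.2 * l.2)); congr cos.
rewrite /dotz /= !(rmorphD, rmorphM) /=; ring.
Qed.

Lemma lift_wave k a : Defs.lift (wave k a) = fun p => cos (2 * pi * dotz k p + a).
Proof. by apply/funext => p; exact: wave_pi. Qed.

Lemma fst_diff p : differentiable (fst : R * R -> R) p.
Proof. apply: linear_differentiable => z; exact: cvg_fst. Qed.

Lemma snd_diff p : differentiable (snd : R * R -> R) p.
Proof. apply: linear_differentiable => z; exact: cvg_snd. Qed.

Lemma phase_differentiable k a p :
  differentiable (fun q => 2 * pi * dotz k q + a : R) p.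
Proof.
rewrite /dotz; apply: differentiableD; last exact: differentiable_cst.
apply: differentiableM; first exact: differentiable_cst.
apply: differentiableD; apply: differentiableM; try exact: differentiable_cst.
  exact: fst_diff.
exact: snd_diff.
Qed.

Lemma cos_phase_differentiable k a p :
  differentiable (fun q => cos (2 * pi * dotz k q + a) : R) p.
Proof.
apply: (@differentiable_comp _ _ _ _ (fun q => 2 * pi * dotz k q + a) cos).
  exact: phase_differentiable.
by apply/derivable1_diffP; have [] := is_derive_cos (2 * pi * dotz k p + a).
Qed.

Lemma continuous_cos_phase k a :
  continuous (fun q => cos (2 * pi * dotz k q + a) : R).
Proof. move=> p; exact/differentiable_continuous/cos_phase_differentiable. Qed.

(** Differentials are evaluated through one-variable derivatives along lines,
both to compute those of waves and to integrate them along orbits. *)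
Lemma line_is_derive (V : normedModType R) (f : V -> R) (p v : V) (t : R) :
  differentiable f (p + t *: v) ->
  is_derive t 1 (fun s : R => f (p + s *: v)) ('d f (p + t *: v) v).
Proof.
move=> df.
have dl : is_diff t (cst p + ( *:%R^~ v)) (0 + ( *:%R^~ v)).
  exact: is_diffD (is_diff_cst p t) (is_diff_scalel t v).
have D : is_diff t (f \o (cst p + ( *:%R^~ v)))
                   ('d f (p + t *: v) \o (0 + ( *:%R^~ v))).
  exact: is_diff_comp dl (differentiableP df).
case: D => dD eD; apply: DeriveDef; first exact/derivable1_diffP.
rewrite deriveE; last exact: dD.
rewrite [X in X _ = _]eD /=.
by rewrite /GRing.add /= /GRing.zero /= add0r scale1r.
Qed.

Lemma diff_cos_phase k a p v :
  'd (fun q => cos (2 * pi * dotz k q + a) : R) p v =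
  - sin (2 * pi * dotz k p + a) * (2 * pi * dotz k v).
Proof.
have H := @line_is_derive (R * R)%type _ p v 0 (@cos_phase_differentiable k a _).
rewrite scale0r addr0 in H.
rewrite -(@derive_val _ _ _ _ _ _ _ H).
have E : (fun s => cos (2 * pi * dotz k (p + s *: v) + a) : R) =
  cos \o (fun s => (2 * pi * dotz k p + a) + (2 * pi * dotz k v) * s).
  by apply/funext => s /=; congr cos; rewrite dotzD dotzZ; ring.
rewrite E.
have D1 : is_derive (0:R) 1
  (fun s : R => (2 * pi * dotz k p + a) + (2 * pi * dotz k v) * s)
  (2 * pi * dotz k v).
  have := is_deriveD (is_derive_cst (2 * pi * dotz k p + a) (0 : R) (1 : R))
    (is_deriveZ (2 * pi * dotz k v) (is_derive_id (0 : R) (1 : R))).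
  by rewrite add0r [_%:A]mulr1.
have D2 := is_derive1_comp (is_derive_cos _) D1.
by rewrite (@derive_val _ _ _ _ _ _ _ D2) mulr0 addr0.
Qed.

Lemma wave_C1 k a : C1 (wave k a).
Proof.
rewrite /C1 lift_wave; split=> [p|v]; first exact: cos_phase_differentiable.
have -> : (fun p => 'd (fun q => cos (2 * pi * dotz k q + a) : R) p v) =
    fun p => (2 * pi * dotz k v) * cos (2 * pi * dotz k p + (a + pi / 2)).
  by apply/funext => p; rewrite diff_cos_phase addrA cosDpihalf; ring.
move=> p; apply: cvgMl_tmp.
exact: continuous_cos_phase.
Qed.

Lemma torus_diff_wave k a x v : torus_diff (wave k a) x v =
  (2 * pi * dotz k v) * wave k (a + pi / 2) x.
Proof.
by rewrite /torus_diff lift_wave diff_cos_phase /wave addrA cosDpihalf; ring.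
Qed.

Lemma wave_continuous k a : continuous (wave k a).
Proof.
apply: torus_continuous; rewrite -[_ \o _]/(Defs.lift _) lift_wave.
exact: continuous_cos_phase.
Qed.

End TorusLemmas.

(** * Measurability on the phase space, and measures of zero action *)

Lemma ae_imply d (T : measurableType d) (R : realType)
    (mu : {measure set T -> \bar R}) (P Q : T -> Prop) :
  (forall x, P x -> Q x) -> {ae mu, forall x, P x} -> {ae mu, forall x, Q x}.
Proof. by move=> PQ; have F := ae_filter_ringOfSetsType mu; exact: filterS. Qed.

Section PhaseMeasurability.
Variable R : realType.

Lemma phase_open_measurable (U : set (torus R * (R * R))) :
  open U -> measurable (U : set (phase R)).
Proof. by move=> oU; exact: sub_sigma_algebra. Qed.

(** It suffices to test open sets, which generate the sigma-algebra of the
phase space. *)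
Lemma measurable_to_phase d (T : measurableType d) (g : T -> phase R) :
  (forall U : set (torus R * (R * R)), open U -> measurable (g @^-1` U)) ->
  measurable_fun setT g.
Proof.
move=> gU; apply: (measurability _) => [|_ [U oU <-]]; first by [].
by rewrite setTI; exact: gU.
Qed.

Lemma continuous_phase_measurable (f : torus R * (R * R) -> R) :
  continuous f -> measurable_fun setT (f : phase R -> R).
Proof.
move=> /continuousP cf.
apply: (measurability _ (RGenOpens.measurableE R)) => _ [_ [x [y ->]] <-].
by rewrite setTI; apply: phase_open_measurable; apply: cf; exact: itv_open.
Qed.

Lemma base_measurable (f : torus R -> R) : continuous f ->
  measurable_fun setT (fun z : phase R => f z.1).
Proof.
move=> cf; apply: (@continuous_phase_measurable (f \o fst)) => z.
by apply: continuous_comp; [exact: cvg_fst|exact: cf].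
Qed.

Lemma velocity1_measurable : measurable_fun setT (fun z : phase R => z.2.1).
Proof.
apply: (@continuous_phase_measurable (fst \o snd)) => z.
by apply: continuous_comp; [exact: cvg_snd|exact: cvg_fst].
Qed.

Lemma velocity2_measurable : measurable_fun setT (fun z : phase R => z.2.2).
Proof.
apply: (@continuous_phase_measurable (snd \o snd)) => z.
by apply: continuous_comp; [exact: cvg_snd|exact: cvg_snd].
Qed.

Lemma enorm_sqr (v : R * R) : enorm v ^+ 2 = v.1 ^+ 2 + v.2 ^+ 2.
Proof. by rewrite sqr_sqrtr// addr_ge0 ?sqr_ge0. Qed.

Lemma enorm_ge0 (v : R * R) : 0 <= enorm v. Proof. exact: sqrtr_ge0. Qed.

Lemma enorm_eq0 (v : R * R) : enorm v = 0 -> v = 0.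
Proof.
move=> v0; have := enorm_sqr v; rewrite v0 expr0n /= => /esym/eqP.
rewrite paddr_eq0 ?sqr_ge0// !sqrf_eq0 => /andP[/eqP a /eqP b].
by case: v {v0} a b => /= ? ? -> ->.
Qed.

(** Continuity is asked of the two components because the measurability lemmas
concern real-valued functions. *)
Definition continuous_field (V : torus R -> R * R) : Prop :=
  continuous (fst \o V) /\ continuous (snd \o V).

Lemma lagrangian_ge0 V (z : phase R) : 0 <= lagrangian V z.
Proof. by rewrite /lagrangian mulr_ge0 ?invr_ge0// sqr_ge0. Qed.

Lemma lagrangian_measurable V : continuous_field V ->
  measurable_fun setT (lagrangian V).
Proof.
move=> [c1 c2].
have -> : lagrangian V = (fun z : phase R => 2^-1 *
    ((z.2.1 - (V z.1).1) ^+ 2 + (z.2.2 - (V z.1).2) ^+ 2)).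
  by apply/funext => z; rewrite /lagrangian enorm_sqr.
apply: measurable_funM => //; apply: measurable_funD.
- apply: measurable_funX; apply: measurable_funB.
  + exact: velocity1_measurable.
  + exact: (base_measurable c1).
- apply: measurable_funX; apply: measurable_funB.
  + exact: velocity2_measurable.
  + exact: (base_measurable c2).
Qed.

Lemma zero_action_ae V (mu : probability (phase R) R) : continuous_field V ->
  (\int[mu]_z (lagrangian V z)%:E = 0)%E ->
  {ae mu, forall z, z.2 = V z.1}.
Proof.
move=> cV L0.
have mL : measurable_fun setT (EFin \o lagrangian V).
  by apply/measurable_EFinP; exact: lagrangian_measurable.
have /ae_eq_integral_abs : (\int[mu]_z `|(EFin \o lagrangian V) z| = 0)%E.
  rewrite -[RHS]L0; apply: eq_integral => z _.
  by rewrite gee0_abs// lee_fin lagrangian_ge0.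
move=> /(_ measurableT mL); apply: filterS => z /(_ Logic.I) /= [] /eqP.
rewrite mulf_eq0 invr_eq0 pnatr_eq0 /= sqrf_eq0 => /eqP /enorm_eq0 /eqP.
by rewrite subr_eq0 => /eqP.
Qed.

(* a closed measure of zero action carried by V is Mather *)
(** Lagrangians are nonnegative, so zero is the least conceivable action. *)
Lemma mather_zero_action V (mu : probability (phase R) R) : closed_measure mu ->
  (\int[mu]_z (lagrangian V z)%:E = 0)%E -> mather_measure (lagrangian V) mu.
Proof.
move=> cmu L0; split => // mu' _; rewrite L0.
by apply: integral_ge0 => z _; rewrite lee_fin lagrangian_ge0.
Qed.

(** Minimality against a competitor of zero action forces zero action, hence
[v = V(x)] almost everywhere. *)
Lemma mather_ae V (mu0 mu : probability (phase R) R) : continuous_field V ->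
  closed_measure mu0 -> (\int[mu0]_z (lagrangian V z)%:E = 0)%E ->
  mather_measure (lagrangian V) mu -> {ae mu, forall z, z.2 = V z.1}.
Proof.
move=> cV c0 L0 [_ /(_ _ c0)]; rewrite L0 => le0.
apply: zero_action_ae => //; apply/eqP; rewrite eq_le le0 /=.
by apply: integral_ge0 => z _; rewrite lee_fin lagrangian_ge0.
Qed.

End PhaseMeasurability.

(** * Bounded limits of trigonometric polynomials *)

Lemma bounded_integrable d (T : measurableType d) (R : realType)
    (mu : probability T R) (f : T -> R) (M : R) :
  measurable_fun setT f -> (forall x, `|f x| <= M) ->
  mu.-integrable setT (EFin \o f).
Proof.
move=> mf fM; apply: measurable_bounded_integrable => //.
  by rewrite (le_lt_trans (probability_le1 _ _))// ltry.
by exists M; split; rewrite ?num_real// => y My x _; apply: le_trans (fM x) (ltW My).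
Qed.

Section SignIteration.
Variable R : realType.

(** A polynomial with fixed points -1, 0 and 1, of which the outer ones attract
the whole of [[-1, 0[] and []0, 1]]. Its iterates approximate the sign function
while remaining polynomials. *)
Definition signum_step (s : R) : R := (3 * s - s ^+ 3) / 2.

Lemma signum_stepN s : signum_step (- s) = - signum_step s.
Proof. by rewrite /signum_step; ring. Qed.

Lemma iter_signum_stepN n s : iter n signum_step (- s) = - iter n signum_step s.
Proof. by elim: n => //= n ->; rewrite signum_stepN. Qed.

(** The distance to 1 is multiplied at each step by
[(1 - t) (2 + t) / 2 <= 1 - t / 2], and the iterates increase, so the ratio
[1 - s / 2] of the first step serves for all of them. *)
Lemma iter_signum_step_pos s n : 0 < s <= 1 ->
  s <= iter n signum_step s <= 1 /\ 1 - iter n signum_step s <= (1 - s / 2) ^+ n.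
Proof.
move=> /andP[s0 s1]; elim: n => [|n [/andP[]]] /=.
  by rewrite expr0 lexx s1; split => //; lra.
set t := iter n _ _ => st t1 tn.
have t2 : 0 <= t * (1 - t ^+ 2).
  by apply: mulr_ge0; [lra|rewrite subr_ge0 expr_le1//; lra].
have h1 : signum_step t = t + t * (1 - t ^+ 2) / 2 by rewrite /signum_step; field.
have h2 : 1 - signum_step t = (1 - t) * ((1 - t) * (2 + t) / 2).
  by rewrite /signum_step; field.
have h3 : 0 <= (1 - t) * (2 + t) / 2 by apply: divr_ge0 => //; apply: mulr_ge0; lra.
have h4 : (1 - t) * (2 + t) / 2 <= 1 - s / 2.
  have -> : (1 - t) * (2 + t) / 2 = 1 - t / 2 - t ^+ 2 / 2 by field.
  have : 0 <= t ^+ 2 by exact: sqr_ge0.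
  lra.
have t1' : 0 <= 1 - t by lra.
split.
  apply/andP; split; first by rewrite h1; lra.
  by rewrite -subr_ge0 h2 mulr_ge0.
rewrite h2 exprSr; apply: ler_pM => //.
Qed.

Lemma iter_signum_step_norm s n : `|s| <= 1 -> `|iter n signum_step s| <= 1.
Proof.
move=> s1; have [s0|s0|->] := ltgtP s 0.
- rewrite -[s]opprK iter_signum_stepN normrN.
  have [] := @iter_signum_step_pos (- s) n.
    by move: s1; rewrite ltr0_norm// => ->; rewrite oppr_gt0 s0.
  by move=> /andP[a b] _; rewrite ger0_norm//; lra.
- have [] := @iter_signum_step_pos s n.
    by move: s1; rewrite gtr0_norm// => ->; rewrite s0.
  by move=> /andP[a b] _; rewrite ger0_norm//; lra.
- have -> : iter n signum_step 0 = 0.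
    by elim: n => //= n ->; rewrite /signum_step mulr0 expr0n /= subrr mul0r.
  by rewrite normr0.
Qed.

Lemma cvg_iter_signum_step s : `|s| <= 1 ->
  (fun n => iter n signum_step s) @ \oo --> Num.sg s.
Proof.
have pos (u : R) : 0 < u <= 1 -> (fun n => iter n signum_step u) @ \oo --> (1 : R).
  move=> u01; apply: (@squeeze_cvgr _ _ _ _ (fun n => 1 - (1 - u / 2) ^+ n) (cst 1)).
  - apply: nearW => n; have [/andP[a b] c] := iter_signum_step_pos n u01.
    by apply/andP; split => //=; lra.
  - rewrite -[X in _ --> X]subr0; apply: cvgB; first exact: cvg_cst.
    apply: cvg_expr; rewrite ltr_norml; move: u01 => /andP[? ?].
    by apply/andP; split; lra.
  - exact: cvg_cst.
move=> s1; have [s0|s0|->] := ltgtP s 0.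
- rewrite ltr0_sg// (_ : (fun n => _) = (fun n => - iter n signum_step (- s))).
    apply: cvgN; apply: pos; move: s1; rewrite ltr0_norm// => ->.
    by rewrite oppr_gt0 s0.
  by apply/funext => n; rewrite iter_signum_stepN opprK.
- by rewrite gtr0_sg//; apply: pos; move: s1; rewrite gtr0_norm// s0 => ->.
- rewrite sgr0 (_ : (fun n => _) = cst 0); first exact: cvg_cst.
  by apply/funext; elim=> //= n ->; rewrite /signum_step mulr0 expr0n /= subrr mul0r.
Qed.

End SignIteration.

Section TrigClosure.
Variable R : realType.
Implicit Types (f g : torus R -> R) (A : set (torus R)) (x : torus R).

(** Only bounded limits are allowed, so that integrals pass to the limit by
dominated convergence, for every probability measure at once. *)
Inductive trig_closure : (torus R -> R) -> Prop :=
| tc_wave k a : trig_closure (wave k a)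
| tc_lin c d f g : trig_closure f -> trig_closure g ->
    trig_closure (fun x => c * f x + d * g x)
| tc_lim (f_ : nat -> torus R -> R) f M :
    (forall n, trig_closure (f_ n)) -> (forall n x, `|f_ n x| <= M) ->
    (forall x, f_ ^~ x @ \oo --> f x) -> trig_closure f.

Lemma tc_ext f g : f =1 g -> trig_closure f -> trig_closure g.
Proof. by move=> /funext ->. Qed.

Lemma wave0 a x : wave (0, 0) a x = cos a.
Proof. by rewrite /wave /dotz /= !mul0r addr0 mulr0 add0r. Qed.

Lemma tc_cst c : trig_closure (fun=> c).
Proof.
apply: (tc_ext _ (tc_lin c 0 (tc_wave (0, 0) 0) (tc_wave (0, 0) 0))) => x.
by rewrite wave0 cos0; ring.
Qed.

Lemma tc_scale c f : trig_closure f -> trig_closure (fun x => c * f x).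
Proof. by move=> tf; apply: (tc_ext _ (tc_lin c 0 tf tf)) => x; ring. Qed.

Lemma tc_add f g : trig_closure f -> trig_closure g ->
  trig_closure (fun x => f x + g x).
Proof. by move=> tf tg; apply: (tc_ext _ (tc_lin 1 1 tf tg)) => x; ring. Qed.

Lemma tc_bounded f : trig_closure f -> exists M, forall x, `|f x| <= M.
Proof.
elim=> {f} [k a|c d f g _ [M hM] _ [N hN]|f_ f M _ _ fM ff].
- exists 1 => x; rewrite ler_norml; apply/andP.
  by split; [exact: cos_geN1|exact: cos_le1].
- exists (`|c| * M + `|d| * N) => x; rewrite (le_trans (ler_normD _ _))// !normrM.
  by apply: lerD; apply: ler_wpM2l.
- exists M => x; rewrite -(cvg_lim _ (cvg_norm (ff x)))//.
  apply: limr_le; first by apply/cvg_ex; eexists; exact: cvg_norm (ff x).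
  by apply: nearW => n /=; exact: fM.
Qed.

Lemma tc_measurable f : trig_closure f ->
  measurable_fun setT (fun z : phase R => f z.1).
Proof.
elim=> {f} [k a|c d f g _ mf _ mg|f_ f M _ mf fM ff].
- apply: base_measurable; exact: wave_continuous.
- by apply: measurable_funD; exact: measurable_funM.
- apply: (measurable_fun_cvg (h := fun n (z : phase R) => f_ n z.1)) => // z _.
Qed.

Lemma wave_mul k a l b x : wave k a x * wave l b x =
  2^-1 * wave (k.1 + l.1, k.2 + l.2) (a + b) x +
  2^-1 * wave (k.1 - l.1, k.2 - l.2) (a - b) x.
Proof.
rewrite /wave /dotz /= !rmorphD /= !rmorphN /=.
set u := (2 * pi * (k.1%:~R * (repr x).1 + k.2%:~R * (repr x).2) + a).
set w := (2 * pi * (l.1%:~R * (repr x).1 + l.2%:~R * (repr x).2) + b).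
have -> : 2 * pi * ((k.1%:~R + l.1%:~R) * (repr x).1 +
  (k.2%:~R + l.2%:~R) * (repr x).2) + (a + b) = u + w by rewrite /u /w; ring.
have -> : 2 * pi * ((k.1%:~R - l.1%:~R) * (repr x).1 +
  (k.2%:~R - l.2%:~R) * (repr x).2) + (a - b) = u - w by rewrite /u /w; ring.
by rewrite (cosD u w) (cosB u w); field.
Qed.

(** By induction on one factor, then on the other: products of waves are sums
of waves, and multiplication by a bounded function respects bounded limits. *)
Lemma tc_mul f g : trig_closure f -> trig_closure g ->
  trig_closure (fun x => f x * g x).
Proof.
move=> tf; elim: tf g => {f} [k a|c d f1 f2 _ h1 _ h2|f_ f M tf h fM ff] g tg.
- elim: tg => {g} [l b|c d g1 g2 _ h1 _ h2|g_ g M tg h gM gg].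
  + apply: (tc_ext _ (tc_lin 2^-1 2^-1 (tc_wave _ _) (tc_wave _ _))) => x.
    exact/esym/wave_mul.
  + by apply: (tc_ext _ (tc_lin c d h1 h2)) => x; ring.
  + have [N hN] := tc_bounded (tc_wave k a).
    apply: (tc_lim (M := N * M) h) => [n x|x].
      by rewrite normrM; apply: ler_pM.
    by apply: cvgMl_tmp; exact: gg.
- by apply: (tc_ext _ (tc_lin c d (h1 _ tg) (h2 _ tg))) => x; ring.
- have [N hN] := tc_bounded tg.
  apply: (tc_lim (M := M * N) (fun n => h n g tg)) => [n x|x].
    by rewrite normrM; apply: ler_pM.
  by apply: cvgMr_tmp; exact: ff.
Qed.

Lemma tc_signum_step f : trig_closure f ->
  trig_closure (fun x => signum_step (f x)).
Proof.
move=> tf; have t3 := tc_mul tf (tc_mul tf tf).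
by apply: (tc_ext _ (tc_lin (3 / 2) (- 2^-1) tf t3)) => x; rewrite /signum_step; field.
Qed.

(** After rescaling into [[-1, 1]], the sign is the limit of the iterates of
[signum_step]. *)
Lemma tc_sg f : trig_closure f -> trig_closure (fun x => Num.sg (f x)).
Proof.
move=> tf; have [M hM] := tc_bounded tf.
have M0 : 0 < `|M| + 1 by rewrite ltr_wpDl.
set c := (`|M| + 1)^-1; have c0 : 0 < c by rewrite invr_gt0.
have tg := tc_scale c tf.
have g1 x : `|c * f x| <= 1.
  rewrite normrM gtr0_norm// mulrC ler_pdivrMr// mul1r (le_trans (hM x))//.
  by rewrite (le_trans (ler_norm M))// lerDl.
apply: (tc_lim (f_ := fun n x => iter n (@signum_step R) (c * f x)) (M := 1)).
- by elim => [|n ih] //=; exact: tc_signum_step.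
- by move=> n x; exact: iter_signum_step_norm.
- move=> x; have := cvg_iter_signum_step (g1 x).
  by rewrite sgrM (gtr0_sg c0) mul1r.
Qed.

Definition tc_set A := trig_closure (fun x => \1_A x).

(** The indicator of the positive reals is [(sgn^2 + sgn) / 2]. *)
Lemma tc_set_pos f : trig_closure f -> tc_set [set x | 0 < f x].
Proof.
move=> /tc_sg ts; apply: (tc_ext _ (tc_lin 2^-1 2^-1 (tc_mul ts ts) ts)) => x.
have -> : \1_[set x | 0 < f x] x = (0 < f x)%R%:R :> R.
  by rewrite indicE; congr (_ %:R); congr nat_of_bool; apply/idP/idP; rewrite inE.
have [f0|f0|->] := ltgtP (f x) 0.
- by rewrite ltr0_sg//= mulr0n; ring.
- by rewrite gtr0_sg//= mulr1n; field.
- by rewrite sgr0 /= mulr0n; ring.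
Qed.

Lemma tc_setC A : tc_set A -> tc_set (~` A).
Proof.
move=> tA; apply: (tc_ext _ (tc_lin 1 (-1) (tc_cst 1) tA)) => x.
by rewrite !indicE in_setC; case: (x \in A) => /=; ring.
Qed.

Lemma tc_set0 : tc_set set0.
Proof. by apply: (tc_ext _ (tc_cst 0)) => x; rewrite indicE in_set0. Qed.

Lemma tc_setI A B : tc_set A -> tc_set B -> tc_set (A `&` B).
Proof.
move=> tA tB; apply: (tc_ext _ (tc_mul tA tB)) => x.
by rewrite !indicE in_setI; case: (x \in A) => /=; ring.
Qed.

Lemma tc_setU A B : tc_set A -> tc_set B -> tc_set (A `|` B).
Proof.
by move=> tA tB; rewrite -[A `|` B]setCK setCU; apply/tc_setC/tc_setI; exact: tc_setC.
Qed.

Lemma tc_bigcup (F : nat -> set (torus R)) :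
  (forall n, tc_set (F n)) -> tc_set (\bigcup_n F n).
Proof.
move=> tF; have tU n : tc_set (\bigcup_(i < n) F i).
  elim: n => [|n ih]; first by rewrite bigcup_mkord big_ord0; exact: tc_set0.
  by rewrite bigcup_mkord big_ord_recr /= -bigcup_mkord; exact: tc_setU.
apply: (tc_lim tU (M := 1)) => [n x|x].
  by rewrite indicE; case: (_ \in _); rewrite ?normr1 ?normr0.
apply: cvg_near_cst; have [[i _ Fi]|nF] := pselect ((\bigcup_n F n) x).
  exists i.+1 => // n /= ni; rewrite !indicE !mem_set//; first by exists i.
  by exists i.
apply: nearW => n; rewrite !indicE !memNset//.
by move=> [i _ Fi]; apply: nF; exists i.
Qed.

Lemma tc_bigcup_count (I : countType) (F : I -> set (torus R)) :
  (forall i, tc_set (F i)) -> tc_set (\bigcup_i F i).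
Proof.
move=> tF.
rewrite (_ : \bigcup_i F i =
    \bigcup_n (if @unpickle I n is Some i then F i else set0)).
  by apply: tc_bigcup => n; case: unpickle => //; exact: tc_set0.
apply/seteqP; split => [x [i _ Fi]|x [n _]].
  by exists (pickle i) => //; rewrite pickleK.
by case: unpickle => // i Fi; exists i.
Qed.

End TrigClosure.

(** * Open sets of the torus, slices of Borel sets, and uniqueness *)

Section OpenSets.
Variable R : realType.
Implicit Types (i : rat * rat * nat) (x : torus R) (p : R * R).

(** Up to half a period, the cosine decreases with the distance to the
integers, which makes closeness modulo 1 a condition on a wave. *)
Lemma lt_cos_2pi (e u : R) : 0 < e <= 2^-1 -> `|u| <= 2^-1 ->
  (cos (2 * pi * e) < cos (2 * pi * u)) = (`|u| < e).
Proof.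
move=> /andP[e0 e1] u1; have pi0 := pi_gt0 R.
have -> : cos (2 * pi * u) = cos (2 * pi * `|u|).
  have [u0|u0] := leP 0 u; first by rewrite ger0_norm.
  by rewrite ltr0_norm// mulrN cosN.
have H (t : R) : 0 <= t <= 2^-1 -> 2 * pi * t \in `[0, pi].
  move=> /andP[t0 t1]; rewrite in_itv /=; apply/andP; split.
    by rewrite !mulr_ge0// ltW.
  by rewrite mulrAC -[leRHS]mul1r ler_pM2r//; lra.
rewrite ltr_cos ?H ?normr_ge0 ?u1 ?(ltW e0)//.
by rewrite ltr_pM2l// mulr_gt0.
Qed.

Lemma nearest_int (u : R) : exists l : int, `|u - l%:~R| <= 2^-1.
Proof.
exists (Num.floor (u + 2^-1)).
have := floor_le_tmp (u + 2^-1); have := floorD1_gt (u + 2^-1).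
rewrite intrD1 => h1 h2; rewrite ler_norml; apply/andP; split; lra.
Qed.

(** Positive exactly when the coordinate selected by [k] lies within
[1/(n+3)] of [a] modulo 1. *)
Definition arc_fun k (a : rat) (n : nat) x : R :=
  wave k (- (2 * pi * ratr a)) x - cos (2 * pi * n.+3%:R^-1).

Lemma tc_arc_fun k a n : trig_closure (arc_fun k a n).
Proof. by apply: tc_add; [exact: tc_wave|exact: tc_cst]. Qed.

Lemma arc_fun_gt0 k a n p (u : R) (l : int) : dotz k p - ratr a = u + l%:~R ->
  `|u| <= 2^-1 -> (0 < arc_fun k a n (\pi_(torus R) p)) = (`|u| < n.+3%:R^-1).
Proof.
move=> E u1; rewrite /arc_fun wave_pi subr_gt0 -lt_cos_2pi//; last first.
  rewrite invr_gt0 ltr0n /= lef_pV2 ?posrE ?ltr0n// ler_nat.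
  by [].
rewrite -(cosD_int (2 * pi * u) l); congr (_ < cos _).
by rewrite -mulrDr -E; ring.
Qed.

(** The image of a box on the torus, described by the positivity of two
trigonometric polynomials. *)
Definition arc_box i : set (torus R) :=
  [set x | 0 < arc_fun (1, 0) i.1.1 i.2 x] `&`
  [set x | 0 < arc_fun (0, 1) i.1.2 i.2 x].

Lemma box_arc_box i p : box i p -> arc_box i (\pi_(torus R) p).
Proof.
have e1 : i.2.+3%:R^-1 <= 2^-1 :> R by rewrite lef_pV2 ?posrE ?ltr0n// ler_nat.
move=> [h1 h2]; split => /=.
- rewrite (@arc_fun_gt0 _ _ _ _ (p.1 - ratr i.1.1) 0)//.
  + by rewrite /dotz /=; ring.
  + exact: le_trans (ltW h1) e1.
- rewrite (@arc_fun_gt0 _ _ _ _ (p.2 - ratr i.1.2) 0)//.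
  + by rewrite /dotz /=; ring.
  + exact: le_trans (ltW h2) e1.
Qed.

Lemma arc_box_box i x : arc_box i x -> exists2 p, box i p & x = \pi_(torus R) p.
Proof.
rewrite -[x]reprK; set q := repr x.
have [l1 n1] := nearest_int (q.1 - ratr i.1.1).
have [l2 n2] := nearest_int (q.2 - ratr i.1.2).
move=> [] /=.
rewrite (@arc_fun_gt0 _ _ _ _ (q.1 - ratr i.1.1 - l1%:~R) l1)//; last first.
  by rewrite /dotz /=; ring.
rewrite (@arc_fun_gt0 _ _ _ _ (q.2 - ratr i.1.2 - l2%:~R) l2)//; last first.
  by rewrite /dotz /=; ring.
(* The representative of [x] closest to the centre of the box. *)
move=> h1 h2; exists (q + ((- l1)%:~R, (- l2)%:~R)); last first.
  by apply/eqP/pi_eqP; exists (- l1, - l2).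
split; rewrite /= rmorphN /=.
- by rewrite -addrA (addrC (- _)) addrA.
- by rewrite -addrA (addrC (- _)) addrA.
Qed.

(** An open set of the torus is the countable union of the images of the
boxes contained in its preimage. *)
Lemma tc_set_open (O : set (torus R)) : open O -> tc_set O.
Proof.
move=> oO; have oO' : open (\pi_(torus R) @^-1` O) by [].
rewrite (_ : O = \bigcup_i
  (if `[< box i `<=` \pi_(torus R) @^-1` O >] then arc_box i else set0)).
  apply: tc_bigcup_count => i; case: ifP => _; last exact: tc_set0.
  by apply: tc_setI; apply: tc_set_pos; exact: tc_arc_fun.
apply/seteqP; split => [x Ox|x [i _]]; last first.
  case: asboolP => // iO /arc_box_box[p ip ->]; exact: iO.
have Op : (\pi_(torus R) @^-1` O) (repr x) by rewrite /= reprK.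
have [i ip iO] := open_rat_box oO' Op.
by exists i => //; rewrite asboolT// -[x]reprK; exact: box_arc_box.
Qed.

(** The sets whose slice at velocity [w] is good form a sigma-algebra, which
contains the open sets. *)
Lemma tc_slice (A : set (phase R)) (w : R * R) : measurable A ->
  tc_set [set x | A (x, w)].
Proof.
move=> mA; suff : measurable `<=` [set B : set (phase R) | tc_set [set x | B (x, w)]].
  by apply.
apply: smallest_sub => [|U oU] /=.
- split => [|B tB|F tF] /=.
  + exact: tc_set0.
  + rewrite (_ : [set x | _] = ~` [set x | B (x, w)]); first exact: tc_setC.
    by apply/seteqP; split => x /= => [[]|].
  + rewrite (_ : [set x | _] = \bigcup_n [set x | F n (x, w)]).
      exact: tc_bigcup.
    by apply/seteqP; split => x [n _ ?]; exists n.
- apply: tc_set_open; have /continuousP : continuous (fun x : torus R => (x, w)).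
    move=> x; have Fx : Filter (nbhs x) by exact: nbhs_filter.
    apply: (@cvg_pair _ _ _ (nbhs x) (nbhs x) (nbhs w)); first exact: cvg_id.
    exact: (@cvg_cst _ _ _ (nbhs x) Fx).
  exact.
Qed.

End OpenSets.

Section Uniqueness.
Variable R : realType.
Implicit Types mu nu : probability (phase R) R.

Lemma tc_integrable mu f : trig_closure f ->
  mu.-integrable setT (fun z : phase R => (f z.1)%:E).
Proof.
move=> tf; have [M fM] := tc_bounded tf.
by apply: (@bounded_integrable _ _ _ _ (fun z : phase R => f z.1) M);
  [exact: tc_measurable|move=> z; exact: fM].
Qed.

Lemma int_wave0 mu a : (\int[mu]_z (wave (0, 0) a z.1)%:E = (cos a)%:E)%E.
Proof.
under eq_integral do rewrite wave0.
by rewrite integral_cst//= probability_setT mule1.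
Qed.

(** Induction on the construction of the function; at frequency 0 a wave is a
constant, whose integral is the same for all probability measures. *)
Lemma tc_integral_eq mu nu :
  (forall k a, k != (0, 0) -> (\int[mu]_z (wave k a z.1)%:E = 0)%E) ->
  (forall k a, k != (0, 0) -> (\int[nu]_z (wave k a z.1)%:E = 0)%E) ->
  forall f, trig_closure f ->
  (\int[mu]_z (f z.1)%:E = \int[nu]_z (f z.1)%:E)%E.
Proof.
move=> mu0 nu0 f; elim=> {f} [k a|c d f g tf hf tg hg|f_ f M tf h fM ff].
- have [->|k0] := eqVneq k (0, 0); first by rewrite !int_wave0.
  by rewrite mu0// nu0.
- have E (m : probability (phase R) R) :
     (\int[m]_z (c * f z.1 + d * g z.1)%:E =
      c%:E * \int[m]_z (f z.1)%:E + d%:E * \int[m]_z (g z.1)%:E)%E.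
    under eq_integral do rewrite EFinD (EFinM c) (EFinM d).
    rewrite integralD//.
    + by rewrite !integralZl//; exact: tc_integrable.
    + by apply: integrableZl => //; exact: tc_integrable.
    + by apply: integrableZl => //; exact: tc_integrable.
  by rewrite !E hf hg.
- have C (m : probability (phase R) R) :
      (fun n => \int[m]_z (f_ n z.1)%:E)%E @ \oo --> (\int[m]_z (f z.1)%:E)%E.
    have mf n : measurable_fun setT (fun z : phase R => (f_ n z.1)%:E).
      by apply/measurable_EFinP; exact: tc_measurable.
    have mff : measurable_fun setT (fun z : phase R => (f z.1)%:E).
      by apply/measurable_EFinP; apply: tc_measurable; exact: tc_lim tf fM ff.
    have [] // := @dominated_convergence _ _ _ m setT measurableT
      (fun n z => (f_ n z.1)%:E) (fun z => (f z.1)%:E) (cst M%:E) mf mff.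
    + by apply: aeW => z _; apply: cvg_EFin; [exact: nearW|exact: ff].
    + exact: finite_measure_integrable_cst.
    + by apply: aeW => z n _; rewrite lee_fin.
  have Ch := C nu.
  rewrite (_ : (fun n => _) = (fun n => \int[mu]_z (f_ n z.1)%:E)%E) in Ch.
    exact: cvg_unique (C mu) Ch.
  by apply/funext => n; rewrite h.
Qed.

(** A measure concentrated on the velocity [w] sees only the slice of a set at
this velocity. *)
Lemma ae_velocity_slice mu w (A : set (phase R)) : measurable A ->
  {ae mu, forall z, z.2 = w} ->
  mu A = (\int[mu]_z (\1_[set x | A (x, w)] z.1)%:E)%E.
Proof.
move=> mA aw; rewrite -[A in LHS]setIT -integral_indic//.
apply: ae_eq_integral => //.
- exact/measurable_EFinP.
- by apply/measurable_EFinP; exact: tc_measurable (tc_slice _ mA).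
- apply: ae_imply aw => -[x v] /= vw _; congr (_%:E).
  rewrite !indicE; congr (_%:R); congr nat_of_bool.
  by apply/idP/idP; rewrite !inE /= vw.
Qed.

End Uniqueness.

(** * Differentials of functions on the torus *)

Section Differentials.
Variable R : realType.
Implicit Types (phi : torus R -> R) (x : torus R) (p v w : R * R).

Lemma lift_period phi p (l : int * int) :
  Defs.lift phi (p + (l.1%:~R, l.2%:~R)) = Defs.lift phi p.
Proof.
by rewrite /Defs.lift /=; congr phi; apply/esym/eqP/pi_eqP; exists l.
Qed.

(** The choice of representative hidden in [torus_diff] is immaterial, since
the lift is periodic. *)
Lemma torus_diff_pi phi p v : C1 phi ->
  torus_diff phi (\pi_(torus R) p) v = 'd (Defs.lift phi) p v.
Proof.
move=> [dphi _]; rewrite /torus_diff; have [l ->] := repr_piE p.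
have H q : is_derive (0 : R) 1 (fun s : R => Defs.lift phi (q + s *: v))
    ('d (Defs.lift phi) q v).
  by have := line_is_derive (dphi (q + 0 *: v)); rewrite scale0r addr0.
have e : (fun s : R => Defs.lift phi (p + (l.1%:~R, l.2%:~R) + s *: v)) =
         (fun s : R => Defs.lift phi (p + s *: v)).
  by apply/funext => s; rewrite addrAC lift_period.
have e1 := @derive_val _ _ _ _ _ _ _ (H (p + (l.1%:~R, l.2%:~R))).
have e2 := @derive_val _ _ _ _ _ _ _ (H p).
by rewrite e in e1; exact: etrans (esym e1) e2.
Qed.

Lemma torus_diff_continuous phi v : C1 phi ->
  continuous (fun x => torus_diff phi x v).
Proof.
move=> cphi; apply: torus_continuous.
rewrite (_ : _ \o _ = fun p => 'd (Defs.lift phi) p v); first exact: cphi.2.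
by apply/funext => p; exact: torus_diff_pi.
Qed.

Lemma torus_diff_coord phi x v : torus_diff phi x v =
  v.1 * torus_diff phi x (1, 0) + v.2 * torus_diff phi x (0, 1).
Proof.
have E : v = v.1 *: ((1, 0) : R * R) + v.2 *: ((0, 1) : R * R).
  case: v => a b; rewrite /= -[RHS]/(a *: 1 + b *: 0, a *: 0 + b *: 1).
  by rewrite ![_ *: 1]mulr1 ![_ *: 0]mulr0 addr0 add0r.
by rewrite /torus_diff [in LHS]E linearD !linearZ.
Qed.

Lemma torus_diff_measurable phi : C1 phi ->
  measurable_fun setT (fun z : phase R => torus_diff phi z.1 z.2).
Proof.
move=> cphi; rewrite (_ : (fun z => _) = fun z : phase R =>
    z.2.1 * torus_diff phi z.1 (1, 0) + z.2.2 * torus_diff phi z.1 (0, 1)).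
  apply: measurable_funD; apply: measurable_funM.
  - exact: velocity1_measurable.
  - exact: base_measurable (torus_diff_continuous cphi).
  - exact: velocity2_measurable.
  - exact: base_measurable (torus_diff_continuous cphi).
by apply/funext => z; exact: torus_diff_coord.
Qed.

Lemma enorm_velocity_measurable :
  measurable_fun setT (fun z : phase R => enorm z.2).
Proof.
apply: (measurableT_comp (f := @Num.sqrt R)).
  by apply: continuous_measurable_fun; exact: sqrt_continuous.
by apply: measurable_funD; apply: measurable_funX;
  [exact: velocity1_measurable|exact: velocity2_measurable].
Qed.

(** The unit square is compact and meets every class. *)
Lemma torus_bounded (f : torus R -> R) : continuous f ->
  exists M, forall x, `|f x| <= M.
Proof.
move=> cf; pose K : set (R * R) := `[0, 1] `*` `[0, 1].
have cK : compact K by apply: compact_setX; exact: segment_compact.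
have cg : {within K, continuous (f \o \pi_(torus R))}.
  apply: continuous_subspaceT => p; apply: continuous_comp; last exact: cf.
  exact: pi_continuous.
have [M [_ HM]] := compact_bounded (continuous_compact cg cK).
exists (M + 1) => x.
pose q := repr x; pose l := (Num.floor q.1, Num.floor q.2).
pose p : R * R := (q.1 - l.1%:~R, q.2 - l.2%:~R).
have -> : x = \pi_(torus R) p.
  rewrite -[x]reprK; apply/eqP/pi_eqP; exists (- l.1, - l.2).
  by rewrite /p /= !rmorphN.
apply: (HM (M + 1)); first by rewrite ltrDl.
exists p => //; split; rewrite /p /= in_itv /=; apply/andP; split.
- by rewrite subr_ge0 floor_le_tmp.
- by rewrite lerBlDr addrC -intrD1 ltW// floorD1_gt.
- by rewrite subr_ge0 floor_le_tmp.
- by rewrite lerBlDr addrC -intrD1 ltW// floorD1_gt.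
Qed.

End Differentials.

(** * Measures carried by closed lines *)

Section UnitInterval.
Variable R : realType.
Notation U01 := (uniform_prob (@ltr01 R)).

(** The density of the uniform law is 1; positive and negative parts reduce the
claim to nonnegative functions. *)
Lemma integral_U01 (f : R -> R) : measurable_fun setT f ->
  (\int[U01]_t (f t)%:E = \int[lebesgue_measure]_(t in `[0%R, 1%R]) (f t)%:E)%E.
Proof.
move=> /measurable_EFinP mf; rewrite integralE [RHS]integralE.
rewrite !integral_uniform//; first by rewrite subr0 invr1 !mul1e.
- exact: measurable_funeneg.
- exact: measurable_funepos.
Qed.

Lemma integral_U01_derive (f F : R -> R) : continuous f ->
  (forall t : R, is_derive t 1 F (f t)) ->
  (\int[U01]_t (f t)%:E = (F 1 - F 0)%:E)%E.
Proof.
move=> cf dF; have cF : continuous F.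
  move=> t; apply/differentiable_continuous/derivable1_diffP; exact: ex_derive.
rewrite integral_U01; last exact: continuous_measurable_fun.
rewrite (@continuous_FTC2 _ f F)//.
- exact: continuous_subspaceT.
- split => [t _||]; first exact: ex_derive.
  + exact: cvg_at_right_filter (cF 0).
  + exact: cvg_at_left_filter (cF 1).
- by move=> t _; rewrite derive1E; exact: derive_val.
Qed.

Lemma line_diff_continuous (phi : torus R -> R) (p v : R * R) : C1 phi ->
  continuous (fun t : R => 'd (Defs.lift phi) (p + t *: v) v : R).
Proof.
move=> cphi t; apply: (@continuous_comp _ _ _ (fun t : R => p + t *: v)
  (fun q => 'd (Defs.lift phi) q v)); last exact: cphi.2.
by apply: continuousD; [exact: cst_continuous|exact: scalel_continuous].
Qed.

(** By the fundamental theorem of calculus the integral is the increment of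
the lift over a period. *)
Lemma period_integral (phi : torus R -> R) (p : R * R) (l : int * int) :
  C1 phi ->
  (\int[U01]_t ('d (Defs.lift phi) (p + t *: ((l.1%:~R, l.2%:~R) : R * R))
     (l.1%:~R, l.2%:~R))%:E = 0)%E.
Proof.
move=> cphi; set v : R * R := (l.1%:~R, l.2%:~R).
have df (t : R) : is_derive t 1 (fun t : R => Defs.lift phi (p + t *: v))
    ('d (Defs.lift phi) (p + t *: v) v : R).
  by apply: line_is_derive; exact: cphi.1.
rewrite (integral_U01_derive (line_diff_continuous (p := p) cphi) df).
by rewrite scale1r scale0r addr0 /v lift_period subrr.
Qed.

(** A closed line may be travelled at any constant speed [c]; the orbit of
direction [(m, p)] is needed with velocity [(1, p/m)]. *)
Lemma closed_line_integral (phi : torus R -> R) (q : R -> R * R) (p w : R * R)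
    (c : R) (l : int * int) : C1 phi ->
  (forall t, q t = p + t *: ((l.1%:~R, l.2%:~R) : R * R)) ->
  w = c *: ((l.1%:~R, l.2%:~R) : R * R) ->
  (\int[U01]_t ('d (Defs.lift phi) (q t) w)%:E = 0)%E.
Proof.
move=> cphi /funext -> ->; set v : R * R := (l.1%:~R, l.2%:~R).
pose D (t : R) : R := 'd (Defs.lift phi) (p + t *: v) v.
have E t : 'd (Defs.lift phi) (p + t *: v) (c *: v) = c * D t.
  by rewrite linearZ.
have [M HM] := torus_bounded (torus_diff_continuous (v := v) cphi).
have iD : (U01 : probability _ _).-integrable setT (EFin \o D).
  apply: (@bounded_integrable _ _ _ _ _ M).
    by apply: continuous_measurable_fun; exact: line_diff_continuous.
  by move=> t; rewrite /D -torus_diff_pi.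
under eq_integral do rewrite E EFinM.
by rewrite integralZl//= period_integral// mule0.
Qed.

Lemma horizontal_loop (phi : torus R -> R) (y : R) : C1 phi ->
  (\int[U01]_x ('d (Defs.lift phi) (x, y) (1%R, 0%R))%:E = 0)%E.
Proof.
move=> cphi; apply: (closed_line_integral (p := (0, y)) (c := 1) (l := (1, 0))) => //.
  by move=> x; rewrite -[RHS]/(0 + x * 1, y + x * 0) mulr1 mulr0 add0r addr0.
by rewrite scale1r.
Qed.

Lemma vertical_loop (phi : torus R -> R) (x : R) : C1 phi ->
  (\int[U01]_y ('d (Defs.lift phi) (x, y) (0%R, 1%R))%:E = 0)%E.
Proof.
move=> cphi; apply: (closed_line_integral (p := (x, 0)) (c := 1) (l := (0, 1))) => //.
  by move=> y; rewrite -[RHS]/(x + y * 0, 0 + y * 1) mulr1 mulr0 add0r addr0.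
by rewrite scale1r.
Qed.

End UnitInterval.

Section ConstantVelocity.
Variable R : realType.

(** The law of [(gamma t, w)] is closed as soon as [dphi.w] has zero mean
along [gamma]. Uniform laws on the square and on a closed orbit are both of
this kind. *)
Lemma constant_velocity_measure d (T : measurableType d) (P : probability T R)
    (gamma : T -> R * R) (w : R * R) :
  (forall O : set (R * R), open O -> measurable (gamma @^-1` O)) ->
  (forall phi, C1 phi -> (\int[P]_t ('d (Defs.lift phi) (gamma t) w)%:E = 0)%E) ->
  exists Q : probability (phase R) R, closed_measure Q /\
    forall V, continuous_field V ->
      (forall t, V (\pi_(torus R) (gamma t)) = w) ->
      (\int[Q]_z (lagrangian V z)%:E = 0)%E.
Proof.
move=> mgamma int0.
pose g (t : T) : phase R := (\pi_(torus R) (gamma t), w).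
have mg : measurable_fun setT g.
  apply: measurable_to_phase => O oO.
  pose h (p : R * R) : torus R * (R * R) := (\pi_(torus R) p, w).
  have ch : continuous h.
    move=> p; apply: (@cvg_pair _ _ _ (nbhs p) (nbhs (\pi_(torus R) p)) (nbhs w)).
      exact: pi_continuous.
    exact: cvg_cst.
  rewrite -[X in measurable X]/(gamma @^-1` (h @^-1` O)).
  by apply: mgamma; move/continuousP: ch; exact.
pose X : {mfun T >-> phase R} := mfun_Sub (mem_set mg).
pose Q : probability (phase R) R := distribution P X.
exists Q; split; first split.
- rewrite ge0_integral_distribution//=.
  + rewrite (_ : (fun _ => _) = cst (enorm w)%:E)//.
    by rewrite integral_cst//= probability_setT mule1 ltry.
  + by apply/measurable_EFinP; exact: enorm_velocity_measurable.
  + by move=> z; rewrite lee_fin enorm_ge0.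
- move=> phi cphi.
  have mD := torus_diff_measurable cphi.
  have [M HM] := torus_bounded (torus_diff_continuous (v := w) cphi).
  have iD : P.-integrable setT (EFin \o (fun t => torus_diff phi (g t).1 (g t).2)).
    apply: (@bounded_integrable _ _ _ _ _ M); first exact: measurableT_comp mD mg.
    by move=> t; exact: HM.
  have mDE : measurable_fun setT
      (EFin \o (fun z : phase R => torus_diff phi z.1 z.2)).
    by apply/measurable_EFinP.
  rewrite (@integral_distribution _ _ _ _ _ P X _ mDE iD) -[RHS](int0 phi cphi).
  by apply: eq_integral => t _ /=; rewrite torus_diff_pi.
- move=> V cV Vw; rewrite ge0_integral_distribution//=.
  + apply: integral0_eq => t _ /=.
    by rewrite /lagrangian /= Vw subrr /enorm /= expr0n /= addr0 sqrtr0 expr0n mulr0.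
  + by apply/measurable_EFinP; exact: lagrangian_measurable.
  + by move=> z; rewrite lee_fin lagrangian_ge0.
Qed.

End ConstantVelocity.

(** * A lower bound for the Wasserstein distance *)

Section Wasserstein.
Variable R : realType.

(** The integral of a nonnegative function is the supremum over the simple
functions below it, so it is monotone even at functions such as [phase_dist],
defined through arbitrary representatives, whose measurability is unclear. *)
Lemma integral_mono d (T : measurableType d) (mu : {measure set T -> \bar R})
    (f g : T -> \bar R) : (forall x, 0 <= f x)%E -> (forall x, f x <= g x)%E ->
  (\int[mu]_x f x <= \int[mu]_x g x)%E.
Proof.
move=> f0 fg; have g0 x : (0 <= g x)%E by exact: le_trans (f0 x) (fg x).
rewrite !ge0_integralTE//; apply: ereal_sup_le => _ [h /= hf <-].
by exists h => // x; exact: le_trans (hf x) (fg x).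
Qed.

Lemma torus_dist_ge0 (x y : torus R) : 0 <= torus_dist x y.
Proof.
apply: lb_le_inf; first by exists (enorm (repr x - repr y - (0%:~R, 0%:~R))), (0, 0).
by move=> _ [k _ <-]; exact: enorm_ge0.
Qed.

Lemma le_phase_dist (z w : phase R) : torus_dist z.1 w.1 <= phase_dist z w.
Proof.
rewrite /phase_dist -[leLHS]ger0_norm ?torus_dist_ge0// -sqrtr_sqr ler_wsqrtr//.
by rewrite lerDl sqr_ge0.
Qed.

(** The easy half of Kantorovich duality. If [F] vanishes almost everywhere
for [nu], then under any coupling [F(x) = max (0, F(x) - F(y))] almost surely,
and the right-hand side is at most [C] times the distance. The positive part
keeps the integrand nonnegative at every point. *)
Lemma W1_ge (mu nu : probability (phase R) R) (F : torus R -> R) (C : R) :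
  0 < C -> (forall x, 0 <= F x) -> continuous F ->
  (forall x y, F x - F y <= C * torus_dist x y) ->
  {ae nu, forall z, F z.1 = 0} ->
  (C^-1%:E * \int[mu]_z (F z.1)%:E <= W1 mu nu)%E.
Proof.
move=> C0 F0 cF FC aF; apply: le_ereal_inf_tmp => _ [Pi [Pi1 Pi2] <-].
have mF : measurable_fun setT (fun z : phase R => F z.1) by exact: base_measurable.
have mF1 : measurable_fun setT (fun p : phase R * phase R => F p.1.1).
  exact: measurableT_comp mF measurable_fst.
have mF2 : measurable_fun setT (fun p : phase R * phase R => F p.2.1).
  exact: measurableT_comp mF measurable_snd.
pose f (p : phase R * phase R) : R := C^-1 * Num.max 0 (F p.1.1 - F p.2.1).
have f0 p : 0 <= f p by rewrite mulr_ge0 ?invr_ge0 ?(ltW C0)// le_max lexx.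
apply: (@le_trans _ _ (\int[Pi]_p (f p)%:E)%E); last first.
  apply: integral_mono => p; rewrite lee_fin// /f mulrC ler_pdivrMr//.
  rewrite ge_max mulr_ge0 ?sqrtr_ge0 ?(ltW C0)//= (le_trans (FC _ _))//.
  by rewrite mulrC ler_wpM2r ?(ltW C0)// le_phase_dist.
have -> : (\int[Pi]_p (f p)%:E = \int[Pi]_p (C^-1 * F p.1.1)%:E)%E.
  apply: ge0_ae_eq_integral => //.
  - apply/measurable_EFinP; apply: measurable_funM => //.
    by apply: measurable_maxr => //; exact: measurable_funB.
  - by apply/measurable_EFinP; apply: measurable_funM.
  - by move=> p _; rewrite lee_fin.
  - by move=> p _; rewrite lee_fin mulr_ge0 ?invr_ge0 ?(ltW C0) ?F0.
  - move: aF => [N [mN N0 FN]]; exists (setT `*` N); split.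
    + exact: measurableX.
    + exact: etrans (Pi2 N mN) N0.
    + move=> p /= np; split => //; apply: FN => /= F20; apply: np => _.
      by rewrite /f F20 subr0 max_r ?F0.
have -> : (\int[Pi]_p (C^-1 * F p.1.1)%:E = \int[mu]_z (C^-1 * F z.1)%:E)%E.
  transitivity (\int[pushforward Pi fst]_z (C^-1 * F z.1)%:E)%E.
    rewrite ge0_integral_pushforward//.
    + by apply/measurable_EFinP; apply: measurable_funM.
    + by move=> z _; rewrite lee_fin mulr_ge0 ?invr_ge0 ?(ltW C0) ?F0.
  apply: eq_measure_integral => A mA _; apply: etrans (Pi1 A mA).
  by congr (Pi _); apply/seteqP; split => p //= [].
under [leRHS]eq_integral do rewrite EFinM.
rewrite ge0_integralZl//.
- exact/measurable_EFinP.
- by move=> z _; rewrite lee_fin F0.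
- by rewrite lee_fin invr_ge0 ltW.
Qed.

End Wasserstein.

Section WaveLipschitz.
Variable R : realType.
Implicit Types (x y : torus R) (k : int * int).

Lemma cos_lipschitz (u v : R) : `|cos u - cos v| <= `|u - v|.
Proof.
wlog uv : u v / u <= v.
  move=> H; have [uv|/ltW uv] := leP u v; first exact: H.
  by rewrite distrC (distrC u); exact: H.
have [|c _ E] := @MVT_segment R cos (fun t => - sin t) u v uv.
  by apply: continuous_subspaceT; exact: continuous_cos.
rewrite distrC E (distrC u) normrM normrN ler_piMl//.
by rewrite ler_norml sin_geN1 sin_le1.
Qed.

(** The l^1 norm of a frequency, which bounds its Euclidean norm. *)
Definition freq_size k : R := `|k.1%:~R| + `|k.2%:~R|.

Lemma dotz_le k (q : R * R) : `|dotz k q| <= freq_size k * enorm q.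
Proof.
have h1 : `|q.1| <= enorm q by rewrite -sqrtr_sqr ler_wsqrtr// lerDl sqr_ge0.
have h2 : `|q.2| <= enorm q by rewrite -sqrtr_sqr ler_wsqrtr// lerDr sqr_ge0.
rewrite (le_trans (ler_normD _ _))// !normrM mulrDl.
by apply: lerD; apply: ler_wpM2l.
Qed.

(** Replacing a representative of [x] by an integer translate does not change
the wave, so the estimate in the plane holds for every term of the infimum
that defines the distance. *)
Lemma wave_lipschitz k a x y : 0 < freq_size k ->
  `|wave k a x - wave k a y| <= 2 * pi * freq_size k * torus_dist x y.
Proof.
move=> k0; have C0 : 0 < 2 * pi * freq_size k by rewrite !mulr_gt0// pi_gt0.
rewrite mulrC -ler_pdivrMr//; apply: lb_le_inf.
  by exists (enorm (repr x - repr y - (0%:~R, 0%:~R))), (0, 0).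
move=> _ [l _ <-]; rewrite ler_pdivrMr// mulrC.
set q := repr x - repr y - _.
have -> : wave k a x = cos (2 * pi * dotz k (repr x - (l.1%:~R, l.2%:~R)) + a).
  rewrite -wave_pi -{1}[x]reprK; congr wave; apply/eqP/pi_eqP.
  by exists (- l.1, - l.2); rewrite /= !rmorphN.
rewrite /wave (le_trans (cos_lipschitz _ _))//.
have -> : 2 * pi * dotz k (repr x - (l.1%:~R, l.2%:~R)) + a -
    (2 * pi * dotz k (repr y) + a) = 2 * pi * dotz k q.
  by rewrite /q /dotz /=; ring.
rewrite normrM ger0_norm ?mulr_ge0 ?pi_ge0//.
by rewrite -[leRHS]mulrA ler_wpM2l ?mulr_ge0 ?pi_ge0// dotz_le.
Qed.

Lemma wave_norm_le1 k a x : `|wave k a x| <= 1.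
Proof. by rewrite ler_norml cos_geN1 cos_le1. Qed.

Lemma wave_sqr_lipschitz k a x y : 0 < freq_size k ->
  wave k a x ^+ 2 - wave k a y ^+ 2 <= 4 * pi * freq_size k * torus_dist x y.
Proof.
move=> k0; rewrite subr_sqr (le_trans (ler_norm _))// normrM.
have h := wave_lipschitz a x y k0.
have h2 : `|wave k a x + wave k a y| <= 2.
  rewrite (le_trans (ler_normD _ _))//.
  by have := wave_norm_le1 k a x; have := wave_norm_le1 k a y; lra.
rewrite (le_trans (ler_pM _ _ h h2))//.
by rewrite le_eqVlt; apply/orP; left; apply/eqP; ring.
Qed.

End WaveLipschitz.

(** * Diophantine approximation, the linear flow, and closedness tested on waves *)

(** An exponent [g > r] with zero lower limit gives arbitrarily large [m] with
[m^g ||m nu|| < 1], and [m^(-g) <= m^(-r)]. *)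
Lemma dioph_approx (R : realType) (nu r : R) : (r%:E < dioph_exponent nu)%E ->
  forall N : nat, exists (m : nat) (p : int),
    (N < m)%N /\ `|m%:R * nu - p%:~R| < m%:R `^ (- r).
Proof.
move=> /ereal_sup_gt[_ [g [g0 lim0] <-]]; rewrite lte_fin => rg N.
set u := (fun m => _) in lim0.
have : (einfs u N.+1 <= 0)%E.
  rewrite -lim0 limn_einf_lim (cvg_lim _ (@cvg_einfs_sup R u))//.
  by apply: ereal_sup_ubound; exists N.+1.
move=> /le_lt_trans /(_ (@lte01 R)) /ereal_inf_lt[_ [m /= Nm <-]].
rewrite /u lte_fin => H.
have m0 : 0 < m%:R :> R by rewrite ltr0n (leq_trans _ Nm).
have mg : 0 < m%:R `^ g by exact: powR_gt0.
have : distZ (m%:R * nu) < m%:R `^ (- g).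
  by rewrite powRN -[ltRHS]mul1r ltr_pdivlMr// mulrC.
move=> /inf_lt[|_ [p _ <-] hp].
  by exists `|m%:R * nu - 0%:~R|, 0.
exists m, p; split => //; apply: lt_le_trans hp _.
by apply: ler_powR; [rewrite ler1n (leq_trans _ Nm)|rewrite lerN2 ltW].
Qed.

Section ClosedMeasures.
Variable R : realType.
Notation U01 := (uniform_prob (@ltr01 R)).
Implicit Types mu : probability (phase R) R.

Definition frequency_field (nu : R) : torus R -> R * R := fun=> (1, nu).

(** Lebesgue measure on the unit square, with constant velocity. Integrating
first along the direction of each partial derivative gives zero by
periodicity. *)
Lemma linear_flow_measure (nu : R) :
  exists Q : probability (phase R) R, closed_measure Q /\
    (\int[Q]_z (lagrangian (frequency_field nu) z)%:E = 0)%E.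
Proof.
pose U : probability _ R := U01.
pose P : probability _ R := (U \x U)%E.
have [||Q [cQ LQ]] := @constant_velocity_measure R _ _ P id (1, nu).
- by move=> O oO; exact: measurable_plane_open.
- move=> phi cphi.
  pose D v (p : R * R) : R := 'd (Defs.lift phi) p v.
  have iD v : P.-integrable setT (EFin \o D v).
    have [M HM] := torus_bounded (torus_diff_continuous (v := v) cphi).
    apply: (@bounded_integrable _ _ _ _ _ M).
      apply: (measurability _ (RGenOpens.measurableE R)) => _ [_ [x [y ->]] <-].
      rewrite setTI; apply: measurable_plane_open.
      by have /continuousP := cphi.2 v; apply; exact: itv_open.
    by move=> p; rewrite /D -torus_diff_pi.
  have I1 : (\int[P]_p (D (1, 0)%R p)%:E = 0)%E.
    rewrite -[LHS](integral21_prod_meas1 (iD _)); apply: integral0_eq => y _.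
    exact: horizontal_loop.
  have I2 : (\int[P]_p (D (0, 1)%R p)%:E = 0)%E.
    rewrite -[LHS](integral12_prod_meas1 (iD _)); apply: integral0_eq => x _.
    exact: vertical_loop.
  have E p : 'd (Defs.lift phi) p (1, nu) = D (1, 0) p + nu * D (0, 1) p.
    by rewrite /D -!torus_diff_pi// torus_diff_coord /= mul1r.
  under eq_integral do rewrite E EFinD EFinM.
  rewrite integralD//; [|exact: iD|by apply: integrableZl => //; exact: iD].
  by rewrite integralZl ?I1//; [rewrite [X in (_ * X)%E]I2 mule0 adde0|exact: iD].
exists Q; split => //; apply: LQ => //.
by split; exact: cst_continuous.
Qed.

(** The closedness of [mu] tested on a wave, with the velocity replaced by the
field that it equals almost everywhere. *)
Lemma closed_wave mu V k a : closed_measure mu -> continuous_field V ->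
  {ae mu, forall z, z.2 = V z.1} ->
  (\int[mu]_z (2 * pi * dotz k (V z.1) * wave k (a + pi / 2) z.1)%:E = 0)%E.
Proof.
move=> [_ /(_ (wave k a)) c0] [cV1 cV2] aV.
rewrite -[RHS](c0 (wave_C1 _ _)).
apply: ae_eq_integral => //.
- apply/measurable_EFinP; apply: measurable_funM.
    apply: measurable_funM => //; apply: measurable_funD; apply: measurable_funM => //.
      exact: (base_measurable cV1).
    exact: (base_measurable cV2).
  exact: (base_measurable (@wave_continuous R k (a + pi / 2))).
- by apply/measurable_EFinP; apply: torus_diff_measurable; exact: wave_C1.
- by apply: ae_imply aV => z /= <- _; rewrite torus_diff_wave.
Qed.

End ClosedMeasures.

(** * Mather measures of the linear flow and of its resonant perturbations *)

Section LinearFlow.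
Variables (R : realType) (nu : R).
Hypothesis irr_nu : @irrational R nu.
Implicit Types mu : probability (phase R) R.

(** The nonresonance of [(1, nu)], equivalent to the irrationality of [nu]. *)
Lemma dotz_irrational_neq0 k : k != (0, 0) -> dotz k (1, nu) != 0.
Proof.
case: k => [k1 k2] /= k0; apply/eqP; rewrite /dotz /= mulr1 => E.
have [k20|k20] := eqVneq k2 0.
  move: k0 E; rewrite k20 mul0r addr0 xpair_eqE eqxx andbT => /negP k0 /eqP.
  by rewrite intr_eq0.
apply: irr_nu; exists (- k1%:~R / k2%:~R) => //.
rewrite fmorph_div rmorphN /= !ratr_int.
have k2R : k2%:~R != 0 :> R by rewrite intr_eq0.
apply: (mulIf k2R); rewrite divfK//; lra.
Qed.

Lemma frequency_field_continuous : continuous_field (frequency_field nu).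
Proof. by split; exact: cst_continuous. Qed.

Lemma linear_mather_ae mu : mather_measure (lagrangian (frequency_field nu)) mu ->
  {ae mu, forall z, z.2 = (1, nu)}.
Proof.
move=> mmu; have [Q [cQ LQ]] := linear_flow_measure nu.
exact: mather_ae frequency_field_continuous cQ LQ mmu.
Qed.

Lemma linear_mather_wave mu k b :
  mather_measure (lagrangian (frequency_field nu)) mu -> k != (0, 0) ->
  (\int[mu]_z (wave k b z.1)%:E = 0)%E.
Proof.
move=> mmu k0; have aV := linear_mather_ae mmu.
(* Differentiation advances the phase by a quarter of a period. *)
have := closed_wave k (b - pi / 2) mmu.1 frequency_field_continuous aV.
rewrite /frequency_field; under eq_integral do rewrite subrK EFinM.
rewrite integralZl//; last exact: tc_integrable (tc_wave _ _).
move=> /eqP; rewrite mule_eq0 => /orP[|/eqP//].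
by rewrite eqe !mulf_eq0 pnatr_eq0 (gt_eqF (pi_gt0 R))
  (negbTE (dotz_irrational_neq0 k0)).
Qed.

Lemma linear_mather_unique mu mu' :
  mather_measure (lagrangian (frequency_field nu)) mu ->
  mather_measure (lagrangian (frequency_field nu)) mu' ->
  forall A, measurable A -> mu A = mu' A.
Proof.
move=> m1 m2 A mA.
rewrite (ae_velocity_slice mA (linear_mather_ae m1)).
rewrite (ae_velocity_slice mA (linear_mather_ae m2)).
apply: tc_integral_eq; last exact: tc_slice.
- by move=> k a; exact: linear_mather_wave.
- by move=> k a; exact: linear_mather_wave.
Qed.

(** The square of a wave is 1/2 plus a wave of twice the frequency. *)
Lemma linear_mather_wave_sqr mu k a :
  mather_measure (lagrangian (frequency_field nu)) mu -> k != (0, 0) ->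
  (\int[mu]_z (wave k a z.1 ^+ 2)%:E = (2^-1)%:E)%E.
Proof.
move=> mmu k0.
have E x : wave k a x ^+ 2 = 2^-1 * wave (k.1 + k.1, k.2 + k.2) (a + a) x + 2^-1.
  by rewrite expr2 wave_mul !subrr wave0 cos0 mulr1.
under eq_integral do rewrite E EFinD EFinM.
have i1 := tc_integrable mu
  (tc_wave (k.1 + k.1, k.2 + k.2) (a + a) : trig_closure (_ : torus R -> R)).
rewrite integralD//.
- rewrite integralZl// linear_mather_wave//; last first.
    by case: (k) k0 => k1 k2; rewrite !xpair_eqE /= -!mulr2n !mulrn_eq0.
  by rewrite mule0 add0e integral_cst//= probability_setT mule1.
- exact: integrableZl.
- exact: (tc_integrable mu (tc_cst 2^-1)).
Qed.

End LinearFlow.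

Section Perturbation.
Variables (R : realType) (m : nat) (p : int) (eta : R).
Hypothesis m0 : (0 < m)%N.
Hypothesis eta0 : 0 < eta.
Implicit Types (x y : torus R) (mu : probability (phase R) R).

(** The integer vector orthogonal to the rational direction [(m, p)], which
approximates [(1, nu)]. *)
Definition resonance : int * int := (- p, m%:Z).

(** A phase of [- pi / 2] makes this the sine of [2 pi (m x_2 - p x_1)]. *)
Definition res_wave x : R := wave resonance (- (pi / 2)) x.

(** The constant field [(1, p/m)] would also leave invariant the measures that
are uniform on the torus, close to that of [(1, nu)]. The added term, transverse
to the closed orbits, selects those on which the sine vanishes. *)
Definition resonant_field x : R * R :=
  (1, p%:~R / m%:R + eta * res_wave x).

Let mR0 : 0 < m%:R :> R. Proof. by rewrite ltr0n. Qed.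

Lemma res_wave_pi q : res_wave (\pi_(torus R) q) =
  sin (2 * pi * (m%:R * q.2 - p%:~R * q.1)).
Proof.
rewrite /res_wave wave_pi cosBpihalf /dotz /=; congr (sin (_ * _)).
by rewrite rmorphN /= -[m%:~R]/(m%:R); ring.
Qed.

Lemma res_wave_continuous : continuous res_wave.
Proof. exact: wave_continuous. Qed.

Lemma freq_size_gt0 : 0 < freq_size R resonance.
Proof.
rewrite /freq_size /= ltr_wpDl// normr_gt0 -[m%:~R]/(m%:R).
by rewrite gt_eqF.
Qed.

Lemma resonant_field_continuous : continuous_field resonant_field.
Proof.
split; first exact: cst_continuous.
move=> x; apply: (@continuous_comp _ _ _ res_wave
    (fun s : R => p%:~R / m%:R + eta * s)); first exact: res_wave_continuous.
by apply: cvgD; [exact: cvg_cst|apply: cvgMl_tmp; exact: cvg_id].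
Qed.

Lemma resonant_field_lipschitz : lipschitz_field resonant_field.
Proof.
exists (eta * (2 * pi * freq_size R resonance)) => x y.
have -> : enorm (resonant_field x - resonant_field y) =
    eta * `|res_wave x - res_wave y|.
  rewrite /enorm /= subrr expr0n /= add0r sqrtr_sqr.
  rewrite -[eta in RHS]gtr0_norm// -normrM; congr `|_|; ring.
by rewrite -mulrA ler_wpM2l ?(ltW eta0)// wave_lipschitz// freq_size_gt0.
Qed.

(** The orbit through 0 of direction [(m, p)] is closed, and [m x_2 - p x_1]
vanishes on it, so the field there is the constant [(1, p/m)]. *)
Lemma resonant_orbit_measure :
  exists Q : probability (phase R) R, closed_measure Q /\
    (\int[Q]_z (lagrangian resonant_field z)%:E = 0)%E.
Proof.
pose U : probability _ R := uniform_prob (@ltr01 R).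
pose gamma (t : R) : R * R := t *: ((m%:~R, p%:~R) : R * R).
have cgamma : continuous gamma.
  by move=> t; exact: scalel_continuous.
have [||Q [cQ LQ]] := @constant_velocity_measure R _ _ U gamma (1, p%:~R / m%:R).
- by move=> O oO; apply: open_measurable; move/continuousP: cgamma; exact.
- move=> phi cphi.
  apply: (closed_line_integral (p := 0) (c := m%:R^-1) (l := (m%:Z, p))) => //=.
    by move=> t; rewrite add0r.
  rewrite -[RHS]/(m%:R^-1 * m%:~R, m%:R^-1 * p%:~R).
  by rewrite -[m%:~R]/(m%:R) mulVf ?gt_eqF// mulrC.
exists Q; split => //; apply: LQ; first exact: resonant_field_continuous.
move=> t; rewrite /resonant_field res_wave_pi.
have -> : m%:R * (gamma t).2 - p%:~R * (gamma t).1 = 0.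
  rewrite -[gamma t]/(t * m%:~R, t * p%:~R) /= -[m%:~R]/(m%:R); ring.
by rewrite mulr0 sin0 mulr0 addr0.
Qed.

Lemma resonant_mather_exists :
  exists mu, mather_measure (lagrangian resonant_field) mu.
Proof.
have [Q [cQ LQ]] := resonant_orbit_measure.
by exists Q; exact: mather_zero_action.
Qed.

(** Along the field, [2 pi k.x] grows at rate [2 pi m eta] times the sine;
testing closedness on a primitive of the sine leaves the integral of its
square, which must vanish. *)
Lemma resonant_mather_ae mu : mather_measure (lagrangian resonant_field) mu ->
  {ae mu, forall z, res_wave z.1 ^+ 2 = 0}.
Proof.
move=> mmu; have [Q [cQ LQ]] := resonant_orbit_measure.
have aV := mather_ae resonant_field_continuous cQ LQ mmu.
have C0 : 2 * pi * (m%:R * eta) != 0 :> R by rewrite gt_eqF// !mulr_gt0// pi_gt0.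
have mw : measurable_fun setT (fun z : phase R => (res_wave z.1 ^+ 2)%:E).
  apply/measurable_EFinP; apply: measurable_funX.
  exact: (base_measurable res_wave_continuous).
(* The phase is [- pi] because differentiation brings it to [- pi / 2]. *)
have := closed_wave resonance (- pi) mmu.1 resonant_field_continuous aV.
have E (z : phase R) : 2 * pi * dotz resonance (resonant_field z.1) *
    wave resonance (- pi + pi / 2) z.1 = 2 * pi * (m%:R * eta) * res_wave z.1 ^+ 2.
  have -> : - pi + pi / 2 = - (pi / 2) :> R by field.
  rewrite -/(res_wave _) /dotz /= rmorphN /= -[m%:~R]/(m%:R).
  by field; rewrite gt_eqF.
under eq_integral do rewrite E EFinM.
rewrite integralZl//; last first.
  have tw := tc_wave resonance (- (pi / 2) : R).
  exact: (tc_integrable mu (tc_mul tw tw)).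
move=> /eqP; rewrite mule_eq0 eqe (negbTE C0) /= => /eqP I0.
have /ae_eq_integral_abs : (\int[mu]_z `|(res_wave z.1 ^+ 2)%:E| = 0)%E.
  by rewrite -[RHS]I0; apply: eq_integral => z _; rewrite gee0_abs// lee_fin sqr_ge0.
move=> /(_ measurableT mw); apply: ae_imply => z /(_ Logic.I) /= [].
exact.
Qed.

(** The value [2 eta] is attained where the sine takes the sign opposite to
that of [nu - p/m]. *)
Lemma resonant_field_sup (nu : R) : eta = `|nu - p%:~R / m%:R| ->
  ereal_sup [set (enorm ((1, nu) - resonant_field x))%:E | x in [set: torus R]] =
  (2 * eta)%:E.
Proof.
move=> etaE; set d := nu - p%:~R / m%:R.
have E x : enorm ((1, nu) - resonant_field x) = `|d - eta * res_wave x|.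
  rewrite /enorm /= subrr expr0n /= add0r sqrtr_sqr; congr `|_|.
  by rewrite opprD addrA.
apply/eqP; rewrite eq_le; apply/andP; split.
  apply: ge_ereal_sup => _ [x _ <-]; rewrite lee_fin E.
  rewrite (le_trans (ler_normB _ _))// normrM -etaE (gtr0_norm eta0).
  have : eta * `|res_wave x| <= eta * 1.
    by rewrite ler_wpM2l ?(ltW eta0)// wave_norm_le1.
  lra.
apply: ereal_sup_ubound; exists (\pi_(torus R) (0, - Num.sg d / (4 * m%:R))) => //.
rewrite E res_wave_pi /= mulr0 subr0; congr (_%:E).
have -> : 2 * pi * (m%:R * (- Num.sg d / (4 * m%:R))) = - Num.sg d * (pi / 2).
  by field; rewrite gt_eqF.
have d0 : d != 0 by rewrite -normr_gt0 -etaE.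
have -> : sin (- Num.sg d * (pi / 2)) = - Num.sg d.
  case: (sgrP d) d0 => //= _ _; first by rewrite mulN1r sinN sin_pihalf.
  by rewrite opprK mul1r sin_pihalf.
have etad : eta = `|d| by [].
rewrite mulrN opprK etad mulrC -numEsg -mulr2n normrMn mulr_natl //.
Qed.

End Perturbation.

(** * The rate *)

Section Estimates.
Variables (R : realType) (nu r : R) (m : nat) (p : int).
Hypothesis m0 : (0 < m)%N.
Hypothesis r0 : 0 < r.
Hypothesis approx : `|m%:R * nu - p%:~R| < m%:R `^ (- r).

Let mR1 : 1 <= m%:R :> R. Proof. by rewrite ler1n. Qed.
Let mR0 : 0 < m%:R :> R. Proof. by rewrite ltr0n. Qed.

Lemma approx_quotient : `|nu - p%:~R / m%:R| = `|m%:R * nu - p%:~R| / m%:R.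
Proof.
rewrite -[X in _ = _ / X]gtr0_norm// -normf_div; congr `|_|.
by field; rewrite gt_eqF.
Qed.

Lemma approx_quotient_lt : `|nu - p%:~R / m%:R| < m%:R `^ (- (r + 1)).
Proof.
rewrite approx_quotient opprD powRD ?(gt_eqF mR0) ?implybT// powR_inv1 ?ltW//.
by rewrite ltr_pM2r ?invr_gt0.
Qed.

Lemma approx_powR_le1 : m%:R `^ (- r) <= 1.
Proof. by rewrite -[leRHS](powRr0 m%:R) ler_powR// oppr_le0 ltW. Qed.

(** The numerator [p] is within 1 of [m nu]. *)
Lemma freq_size_le : freq_size R (resonance m p) <= (`|nu| + 2) * m%:R.
Proof.
rewrite /freq_size /= rmorphN normrN -[m%:~R]/(m%:R) (gtr0_norm mR0).
have h : `|p%:~R| <= `|m%:R * nu| + `|m%:R * nu - p%:~R| :> R.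
  by rewrite -[X in `|X| <= _](subKr (m%:R * nu)) ler_normB.
have h2 := le_trans (ltW approx) approx_powR_le1.
rewrite normrM (gtr0_norm mR0) in h.
have := mR1; lra.
Qed.

(** The power turns [m^(-(r+1))] into [1/m], and the factor 2 can only
decrease. *)
Lemma delta_powR_le :
  (2 * `|nu - p%:~R / m%:R|) `^ (r + 1)^-1 <= 2 / m%:R.
Proof.
have r1 : 0 < r + 1 by rewrite addr_gt0.
have i0 : 0 <= (r + 1)^-1 by rewrite invr_ge0 ltW.
apply: (@le_trans _ _ ((2 * m%:R `^ (- (r + 1))) `^ (r + 1)^-1)).
  apply: ge0_ler_powR => //.
  - by rewrite nnegrE mulr_ge0.
  - by rewrite nnegrE mulr_ge0// powR_ge0.
  - by rewrite ler_pM2l// ltW// approx_quotient_lt.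
rewrite powRM ?powR_ge0// -powRrM mulNr divff ?gt_eqF// powR_inv1 ?(ltW mR0)//.
rewrite ler_pM2r ?invr_gt0// -[leRHS]powRr1//; apply: ler_powR.
  by rewrite ler1n.
by rewrite invf_le1// lerDr ltW.
Qed.

Lemma delta_le : 2 * `|nu - p%:~R / m%:R| <= 2 / m%:R.
Proof.
rewrite approx_quotient ler_pM2l// -[leRHS]mul1r ler_pM2r ?invr_gt0//.
exact: le_trans (ltW approx) approx_powR_le1.
Qed.

(** Both sides are of order [1/m]: the left one by the quality of the rational
approximation, the right one because the frequency is of order [m]. *)
Lemma rate_le (C := 4 * pi * freq_size R (resonance m p)) :
  (16 * pi * (`|nu| + 2))^-1 * (2 * `|nu - p%:~R / m%:R|) `^ (r + 1)^-1
  <= C^-1 * 2^-1.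
Proof.
have pi0 := pi_gt0 R.
have C0 : 0 < C by rewrite /C !mulr_gt0// freq_size_gt0.
have K0 : 0 < `|nu| + 2 by rewrite ltr_wpDl.
apply: (@le_trans _ _ ((16 * pi * (`|nu| + 2))^-1 * (2 / m%:R))).
  by rewrite ler_wpM2l ?delta_powR_le// invr_ge0 !mulr_ge0// ltW.
have -> : (16 * pi * (`|nu| + 2))^-1 * (2 / m%:R) =
    (8 * pi * ((`|nu| + 2) * m%:R))^-1.
  by move: (pi : R) pi0 => P P0; field; rewrite !gt_eqF.
have -> : C^-1 * 2^-1 = (8 * pi * freq_size R (resonance m p))^-1.
  rewrite /C; move: (pi : R) pi0 (freq_size _ _) (freq_size_gt0 R p m0) => P P0 f f0.
  by field; rewrite !gt_eqF.
rewrite lef_pV2 ?posrE ?mulr_gt0// ?freq_size_gt0//.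
by rewrite ler_pM2l ?freq_size_le// mulr_gt0.
Qed.

End Estimates.

Lemma resonant_W1_ge (R : realType) (nu : R) (m : nat) (p : int) (eta : R)
    (M0 mu : probability (phase R) R) :
  @irrational R nu -> (0 < m)%N -> 0 < eta ->
  mather_measure (lagrangian (frequency_field nu)) M0 ->
  mather_measure (lagrangian (resonant_field m p eta)) mu ->
  (((4 * pi * freq_size R (resonance m p))^-1 * 2^-1)%:E <= W1 M0 mu)%E.
Proof.
move=> irr m0 eta0 mM0 mmu; have k0 := freq_size_gt0 R p m0.
have C0 : 0 < 4 * pi * freq_size R (resonance m p).
  by rewrite !mulr_gt0// pi_gt0.
have kn0 : resonance m p != (0, 0).
  by rewrite xpair_eqE negb_and orbC eqz_nat -lt0n m0.
have := @W1_ge R M0 mu (fun x => res_wave m p x ^+ 2) _ C0 (fun x => sqr_ge0 _).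
rewrite (linear_mather_wave_sqr irr _ mM0 kn0) -EFinM; apply.
- move=> x; apply: (@continuous_comp _ _ _ (res_wave m p) (fun s : R => s ^+ 2)).
    exact: res_wave_continuous.
  exact: exprn_continuous.
- by move=> x y; exact: wave_sqr_lipschitz.
- exact: resonant_mather_ae mmu.
Qed.

Theorem theorem3p8 (R : realType) (nu : R) (hnu : @irrational R nu)
  (htau1 : (1%:E <= dioph_exponent nu)%E)
  (htau : (dioph_exponent nu < +oo)%E)
  (r : R) (hr0 : 0 < r) (hr : (r%:E < dioph_exponent nu)%E) :
  let V0 : torus R -> R * R := fun=> (1, nu) in
  exists M0 : probability (phase R) R,
    [/\ mather_measure (lagrangian V0) M0,
        (forall mu : probability (phase R) R,
           mather_measure (lagrangian V0) mu ->
           forall A, measurable A -> mu A = M0 A) &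
        exists (delta : nat -> R) (V : nat -> torus R -> R * R) (c : R),
          [/\ (forall j, 0 < delta j) /\ delta @ \oo --> (0 : R),
              forall j, lipschitz_field (V j),
              forall j, ereal_sup [set (enorm (V0 x - V j x))%:E
                                    | x in [set: torus R]] = (delta j)%:E,
              0 < c &
              forall j,
                (exists mu, mather_measure (lagrangian (V j)) mu) /\
                (forall mu, mather_measure (lagrangian (V j)) mu ->
                   ((c * delta j `^ (r + 1)^-1)%:E <= W1 M0 mu)%E)]].
Proof.
move=> V0; have [M0 [cM0 LM0]] := linear_flow_measure nu.
have mM0 : mather_measure (lagrangian V0) M0 := mather_zero_action cM0 LM0.
exists M0; split => //.
  by move=> mu mmu A mA; exact: (linear_mather_unique hnu mmu mM0).
have [m hm] := choice (dioph_approx hr); have [p mp] := choice hm.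
have m0 j : (0 < m j)%N by exact: leq_trans (mp j).1.
pose eta j : R := `|nu - (p j)%:~R / (m j)%:R|.
have eta0 j : 0 < eta j.
  rewrite normr_gt0 subr_eq0; apply/eqP => E; apply: hnu.
  exists ((p j)%:~R / (m j)%:R) => //.
  by rewrite fmorph_div /= ratr_int ratr_nat -E.
exists (fun j => 2 * eta j), (fun j => resonant_field (m j) (p j) (eta j)).
exists (16 * pi * (`|nu| + 2))^-1; split.
- split=> [j|]; first by rewrite mulr_gt0.
  apply: (@squeeze_cvgr _ _ _ _ (cst 0) (fun j => 2 * j.+1%:R^-1)).
  + apply: nearW => j; rewrite mulr_ge0 ?(ltW (eta0 j))//=.
    rewrite (le_trans (delta_le (m0 j) hr0 (mp j).2))// ler_pM2l//.
    by rewrite lef_pV2 ?posrE ?ltr0n// ler_nat (mp j).1.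
  + exact: cvg_cst.
  + rewrite -[X in _ --> X](mulr0 2); apply: cvgMl_tmp.
    exact: cvg_harmonic.
- by move=> j; exact: resonant_field_lipschitz.
- by move=> j; exact: resonant_field_sup.
- by rewrite invr_gt0 !mulr_gt0 ?pi_gt0// ltr_wpDl.
- move=> j; split; first exact: resonant_mather_exists.
  move=> mu mmu; apply: le_trans (resonant_W1_ge hnu (m0 j) (eta0 j) mM0 mmu).
  by rewrite lee_fin; exact: rate_le (m0 j) hr0 (mp j).2.
Qed.
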